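(* Let $\beta\in(1,2)$ and $c>0$, and let $\rho$ be a probability density on $[0,1]^2$ (with respect to Lebesgue measure) which is continuous on $[0,1]^2\setminus\{(1,1)\}$ and satisfies $$\rho(x,y)=\Theta\left(d^{\frac{\beta}{1-\beta}}\exp\left(-c\,|x-y|\,d^{\frac{\beta}{1-\beta}}\right)\right)\quad\text{as }(x,y)\to(1,1),$$ where $d:=|x-1|+|y-1|$. Then $$\mathbb{E}\left[\mathrm{LIS}\left(\mathrm{Sample}_N(\mu_\rho)\right)\right]=\widetilde{\Theta}\left(N^{1/\beta}\right)\quad\text{as }N\to\infty.$$
   Context: For points $X_1,\dots,X_N\in[0,1]^2$ with pairwise distinct $x$-coordinates and pairwise distinct $y$-coordinates, $\mathrm{Perm}(X_1,\dots,X_N)$ is the permutation $\sigma$ of $\{1,\dots,N\}$ such that $\sigma(i)=j$ whenever the point with $i$-th lowest $x$-coordinate has $j$-th lowest $y$-coordinate. A pre-permuton is a probability measure $\mu$ on $[0,1]^2$ whose two marginals have no atoms. For a pre-permuton $\mu$, $\mathrm{Sample}_N(\mu)$ denotes the random permutation $\mathrm{Perm}(X_1,\dots,X_N)$ where $X_1,\dots,X_N$ are i.i.d. with law $\mu$ (almost surely well defined). For a probability density $\rho$ on $[0,1]^2$ with respect to Lebesgue measure, $\mu_\rho$ is the probability measure with density $\rho$. For a permutation $\sigma$ of size $N$, $\mathrm{LIS}(\sigma)$ is the maximal $k$ such that there exist $i_1<\dots<i_k$ with $\sigma(i_1)<\dots<\sigma(i_k)$. For functions, $F=\Theta(G)$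 as $(x,y)\to(1,1)$ means that there are constants $0<c_1\le c_2$ such that $c_1G\le F\le c_2G$ at all points of $[0,1]^2\setminus\{(1,1)\}$ in some neighborhood of $(1,1)$. For sequences of positive reals, $a_N=\widetilde{\mathcal O}(b_N)$ means that there exist $c_1>0$, $c_2\in\mathbb{R}$ and $N_0$ with $a_N\le c_1\log(N)^{c_2}b_N$ for all $N\ge N_0$; and $a_N=\widetilde{\Theta}(b_N)$ means $a_N=\widetilde{\mathcal O}(b_N)$ and $b_N=\widetilde{\mathcal O}(a_N)$. *)

(* Defs.v *)
From HB Require Import structures.
From mathcomp Require Import all_boot all_order all_algebra all_fingroup.
From mathcomp Require Import all_classical all_reals all_analysis.
From mathcomp Require Import measurable_realfun.

Set Implicit Arguments.
Unset Strict Implicit.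
Unset Printing Implicit Defensive.

Import Order.TTheory GRing.Theory Num.Theory.
Import numFieldNormedType.Exports.

Local Open Scope classical_set_scope.
Local Open Scope ring_scope.

Section Permutations.

Lemma coord_rank_subproof (R : realType) (n : nat) (f : 'I_n -> R) (k : 'I_n) :
  (#|[set j : 'I_n | (f j < f k)%R]%SET| < n)%N.
Proof.
rewrite -[X in (_ < X)%N]card_ord -cardsT; apply: proper_card.
by apply/properP; split; [exact: finset.subsetT | exists k; rewrite !inE ?ltxx].
Qed.

(* 0-based: [coord_rank f k = i] when [f k] is the (i+1)-th lowest of the values of
   [f], provided that [f] is injective *)
Definition coord_rank (R : realType) (n : nat) (f : 'I_n -> R) (k : 'I_n) : 'I_n :=
  Ordinal (coord_rank_subproof f k).

Lemma coord_rank_inj (R : realType) (n : nat) (f : 'I_n -> R) :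
  injective f -> injective (coord_rank f).
Proof.
have mono i j : f i < f j -> (coord_rank f i < coord_rank f j)%N.
  move=> ij; apply: proper_card; apply/properP; split.
    by apply/fintype.subsetP => k; rewrite !inE => /lt_trans; apply.
  by exists i; rewrite !inE ?ltxx.
move=> finj i j rij; apply: finj; case: (ltgtP (f i) (f j)) => // /mono.
  by rewrite rij ltnn.
by rewrite rij ltnn.
Qed.

Definition xcoord (R : realType) (n : nat) (X : n.-tuple (R * R)) (k : 'I_n) : R :=
  (tnth X k).1.

Definition ycoord (R : realType) (n : nat) (X : n.-tuple (R * R)) (k : 'I_n) : R :=
  (tnth X k).2.

(* the identity is a default value, which matters only when two of the points
   share an x-coordinate or a y-coordinate (see [Perm_pointsE] and [Perm_pointsP]) *)
Definition Perm_points (R : realType) (n : nat) (X : n.-tuple (R * R)) : 'S_n :=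
  odflt 1%g
    [pick s : 'S_n | [forall k, s (coord_rank (xcoord X) k) == coord_rank (ycoord X) k]].

Lemma Perm_pointsE (R : realType) (n : nat) (X : n.-tuple (R * R)) :
  injective (xcoord X) -> injective (ycoord X) ->
  forall k, Perm_points X (coord_rank (xcoord X) k) = coord_rank (ycoord X) k.
Proof.
move=> /coord_rank_inj xinj /coord_rank_inj yinj; rewrite /Perm_points.
case: pickP => [s /forallP + k|/(_ ((perm xinj)^-1 * perm yinj)%g)].
  by move=> /(_ k)/eqP.
move=> /negP; case; apply/forallP => k.
by rewrite permM -[coord_rank (xcoord X) k](permE xinj) permK permE.
Qed.

Lemma Perm_pointsP (R : realType) (n : nat) (X : n.-tuple (R * R)) (s : 'S_n) :
  injective (xcoord X) -> injective (ycoord X) ->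
  (forall k, s (coord_rank (xcoord X) k) = coord_rank (ycoord X) k) -> Perm_points X = s.
Proof.
move=> xinj yinj sE; apply/permP => i.
have [g _ gK] := injF_bij (coord_rank_inj xinj).
by rewrite -[i]gK Perm_pointsE // sE.
Qed.

Definition LIS (n : nat) (s : 'S_n) : nat :=
  \max_(k < n.+1 | [exists i : {ffun 'I_k -> 'I_n},
      [forall a : 'I_k, forall b : 'I_k, (a < b)%N ==> (i a < i b)%N && (s (i a) < s (i b))%N]])
    k.

End Permutations.

Section PermMeasurable.
Context {R : realType} {n : nat}.
Let pat (X : n.-tuple (R * R)) : {ffun 'I_n * 'I_n -> bool * bool} :=
  [ffun ij => (xcoord X ij.1 < xcoord X ij.2, ycoord X ij.1 < ycoord X ij.2)].

Let Perm_points_pat X Y : pat X = pat Y -> Perm_points X = Perm_points Y.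
Proof.
move=> /ffunP XY.
have rx k : coord_rank (xcoord X) k = coord_rank (xcoord Y) k.
  apply/val_inj/eq_card => j; rewrite !inE.
  by have := XY (j, k); rewrite !ffunE => -[].
have ry k : coord_rank (ycoord X) k = coord_rank (ycoord Y) k.
  apply/val_inj/eq_card => j; rewrite !inE.
  by have := XY (j, k); rewrite !ffunE => -[].
rewrite /Perm_points; congr odflt; apply: eq_pick => s /=.
by apply: eq_forallb => k; rewrite rx ry.
Qed.

Let mcoord (f : R * R -> R) i : measurable_fun setT f ->
  measurable_fun setT (fun X : n.-tuple (R * R) => f (tnth X i)).
Proof. by move=> mf; apply: measurableT_comp => //; exact: measurable_tnth. Qed.

Let mpat p : measurable [set X | pat X = p].
Proof.
rewrite (_ : [set X | _] = \big[setI/setT]_(ij : 'I_n * 'I_n)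
   [set X | pat X ij = p ij]); last first.
  apply/seteqP; split => X /= HX.
    by elim/big_ind : _ => //= ij _; rewrite HX.
  by apply/ffunP => ij; rewrite (bigD1 ij) //= in HX; case: HX.
apply: bigsetI_measurable => -[i j] _.
pose bx (X : n.-tuple (R * R)) := xcoord X i < xcoord X j.
pose b_y (X : n.-tuple (R * R)) := ycoord X i < ycoord X j.
rewrite (_ : [set X | _] = bx @^-1` [set (p (i, j)).1] `&` b_y @^-1` [set (p (i, j)).2]).
  have mbx : measurable_fun setT bx.
    by apply: measurable_fun_ltr; exact: (@mcoord fst).
  have mby : measurable_fun setT b_y.
    by apply: measurable_fun_ltr; exact: (@mcoord snd).
  by apply: measurableI; rewrite -[X in measurable X]setTI; [apply: mbx|apply: mby].
apply/seteqP; split => X /=; rewrite ffunE /bx /b_y /=; first by move=> <-.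
by case: (p (i, j)) => a b /= [-> ->].
Qed.

Lemma measurable_Perm_points (s : 'S_n) :
  measurable [set X : n.-tuple (R * R) | Perm_points X = s].
Proof.
rewrite (_ : [set X | _] =
    \big[setU/set0]_(p | `[< exists2 Y, pat Y = p & Perm_points Y = s >]) [set X | pat X = p]).
  by apply: bigsetU_measurable => p _; exact: mpat.
apply/seteqP; split => X /= HX.
  by rewrite (bigD1 (pat X)) /=; [left|apply/asboolP; exists X].
elim/big_ind : _ HX => //= [A B hA hB []// |p /asboolP[Y <- <-]].
exact: Perm_points_pat.
Qed.
End PermMeasurable.

Section IndependentSample.
Context {d : measure_display} {T : measurableType d} {R : realType}.

Definition tuple_cons (n : nat) (p : T * n.-tuple T) : n.+1.-tuple T :=
  [tuple of p.1 :: p.2].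

Lemma measurable_tuple_cons (n : nat) :
  measurable_fun [set: T * n.-tuple T] (@tuple_cons n).
Proof. exact: measurable_cons. Qed.

HB.instance Definition _ (n : nat) :=
  isMeasurableFun.Build _ _ _ _ (@tuple_cons n) (@measurable_tuple_cons n).

(* the joint law of [n] independent random variables with law [mu] *)
Fixpoint iid_law (mu : probability T R) (n : nat) :
    probability (n.-tuple T) R :=
  match n return probability (n.-tuple T) R with
  | 0 => \d_([tuple] : 0.-tuple T)
  | n'.+1 => distribution (mu \x iid_law mu n')%E (@tuple_cons n')
  end.

Lemma iid_law_box (mu : probability T R) (n : nat) (A : 'I_n -> set T) :
  (forall i, measurable (A i)) ->
  iid_law mu n [set X | forall i, A i (tnth X i)] = (\prod_(i < n) mu (A i))%E.
Proof.
elim: n A => [A _|n IHn A mA].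
  rewrite big_ord0 /= diracE mem_set//=; by case.
rewrite big_ord_recl /= /distribution /pushforward.
have mB : measurable [set X : n.-tuple T | forall i, A (lift ord0 i) (tnth X i)].
  rewrite (_ : [set X | _] =
      \big[setI/setT]_(i < n) ((fun X : n.-tuple T => tnth X i) @^-1` A (lift ord0 i))).
    apply: bigsetI_measurable => i _; rewrite -[X in measurable X]setTI.
    by apply: measurable_tnth => //; exact: mA.
  apply/seteqP; split => X /= HX.
    by elim/big_ind : _ => //= i _; exact: HX.
  by move=> i; rewrite (bigD1 i) //= in HX; case: HX.
rewrite -(IHn (fun i => A (lift ord0 i))) => [|i]; last exact: mA.
rewrite -product_measure1E //; congr ((_ \x _)%E _).
apply/seteqP; split=> -[x X] /= H.
  by split=> [|i]; [have := H ord0 | have := H (lift ord0 i)]; rewrite /tuple_cons ?tnthS ?tnth0.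
by case: H => Hx HX i; case: (unliftP ord0 i) => [j ->|->]; rewrite /tuple_cons ?tnthS ?tnth0 //.
Qed.

End IndependentSample.

Section Permutons.
Context {R : realType}.

Definition unit_square : set (R * R) := `[0, 1]%classic `*` `[0, 1]%classic.

Definition pre_permuton (mu : probability (R * R)%type R) : Prop :=
  mu unit_square = 1%E /\
  forall a : R, mu ([set a] `*` setT) = 0%E /\ mu (setT `*` [set a]) = 0%E.

Local Notation lebesgue2 := (@lebesgue_measure R \x @lebesgue_measure R)%E.

Lemma measurable_unit_square : measurable unit_square.
Proof. by apply: measurableX. Qed.

(* only the values on [unit_square] matter *)
Record density := Density {
  density_fun :> R * R -> R;
  density_ge0 : forall p, unit_square p -> 0 <= density_fun p;
  density_measurable : measurable_fun unit_square density_fun;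
  density_integral1 :
    (\int[lebesgue2]_(p in unit_square) (density_fun p)%:E = 1)%E }.

Definition mu_ (rho : density) : set (R * R) -> \bar R :=
  fun A => (\int[lebesgue2]_(p in A `&` unit_square) (rho p)%:E)%E.

Section mu_probability.
Variable rho : density.

Let mu0 : mu_ rho set0 = 0%E.
Proof. by rewrite /mu_ set0I integral_set0. Qed.

Let mu_ge0 A : (0 <= mu_ rho A)%E.
Proof.
by apply: integral_ge0 => p [_ sp]; rewrite lee_fin; exact: density_ge0.
Qed.

Let mu_sigma_additive : semi_sigma_additive (mu_ rho).
Proof.
move=> F mF tF mUF; rewrite /mu_ setI_bigcupl.
have sF k : F k `&` unit_square `<=` unit_square by move=> p [].
have mFs k : measurable (F k `&` unit_square).
  by apply: measurableI => //; exact: measurable_unit_square.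
rewrite ge0_integral_bigcup //=.
- apply: is_cvg_ereal_nneg_natsum_cond => n _ _.
  by apply: integral_ge0 => p [_ sp]; rewrite lee_fin; exact: density_ge0.
- apply/measurable_EFinP; apply: (@measurable_funS _ _ _ _ unit_square).
  + exact: measurable_unit_square.
  + by move=> p [k _ []].
  + exact: density_measurable.
- by move=> p [k _ [_ sp]]; rewrite lee_fin; exact: density_ge0.
- exact: trivIset_setIr.
Qed.

HB.instance Definition _ := isMeasure.Build _ _ _
  (mu_ rho) mu0 mu_ge0 mu_sigma_additive.

Let mu_setT : mu_ rho [set: _] = 1%E.
Proof. by rewrite /mu_ setTI density_integral1. Qed.

HB.instance Definition _ :=
  @Measure_isProbability.Build _ _ R (mu_ rho) mu_setT.

End mu_probability.

Lemma mu_pre_permuton (rho : density) : pre_permuton (mu_ rho).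
Proof.
have nul N : measurable N -> lebesgue2 N = 0%E -> mu_ rho N = 0%E.
  move=> mN N0; apply: null_set_integral.
  - by apply: measurableI => //; exact: measurable_unit_square.
  - apply/measurable_EFinP; apply: (@measurable_funS _ _ _ _ unit_square).
    + exact: measurable_unit_square.
    + by move=> p [].
    + exact: density_measurable.
  - apply: (@subset_measure0 _ _ _ lebesgue2 _ N) => //.
    + by apply: measurableI => //; exact: measurable_unit_square.
split; first by rewrite /= /mu_ setIid density_integral1.
move=> a; split; apply: nul; try exact: measurableX.
- by rewrite product_measure1E//= lebesgue_measure_set1 mul0e.
- by rewrite product_measure1E//= lebesgue_measure_set1 mule0.
Qed.

End Permutons.

(* [Sample_N(mu)] is the random permutation [X |-> Perm_points X] on the probability
   space [N.-tuple (R * R)] endowed with [iid_law mu N] *)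
Definition expected_LIS_Sample (R : realType) (mu : probability (R * R)%type R)
    (N : nat) : R :=
  fine 'E_(iid_law mu N)[fun X => (LIS (Perm_points X))%:R].

Section Asymptotics.
Context {R : realType}.

Definition Theta_at_11 (F G : R * R -> R) : Prop :=
  exists c1 c2 : R, [/\ 0 < c1, c1 <= c2 &
    \forall p \near ((1, 1) : R * R), unit_square p -> p != (1, 1) ->
      c1 * G p <= F p <= c2 * G p].

Definition Otilde (a b : nat -> R) : Prop :=
  exists (c1 c2 : R) (N0 : nat), 0 < c1 /\
    forall N, (N0 <= N)%N -> a N <= c1 * (ln N%:R `^ c2) * b N.

Definition Thetatilde (a b : nat -> R) : Prop := Otilde a b /\ Otilde b a.

End Asymptotics.

(* Main.v *)
(* Put g = beta / (beta - 1), so that g > 2 and the density is comparable, near (1,1), to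
   the cusp d^(-g) exp(-c |x - y| d^(-g)).

   Upper bound. The density is at most a constant times (1-x)^(-g/2) (1-y)^(-g/2). Cut the
   square [0, 1-tau]^2, with tau = N^(-1/g), into a product grid by the level sets of the
   integer part of N^(1/2) (1-x)^(1-g/2): there are about M = N^(1/beta) levels and every cell
   has mass O(1/N). An increasing sequence meets at most 2M + 1 cells, and the largest number
   of sample points in a cell is O(log N) in expectation, by an exponential moment. Outside of
   [0, 1-tau]^2 there are on average O(N tau) = O(N^(1/beta)) points, because the marginals of
   the cusp have bounded densities.

   Lower bound. About N^(1/beta) successive diagonal squares of side 1/N fit at distance
   between tau and 2 tau from the corner. The density is of order N on each of them, hence
   each contains a sample point with probability bounded below, and one point in each nonempty
   square gives an increasing sequence. *)
Require Import Defs.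
From mathcomp Require Import all_boot all_order all_algebra.
From mathcomp Require Import perm.
From mathcomp Require Import all_classical all_reals all_analysis.
From mathcomp Require Import measurable_realfun.
From mathcomp Require Import ring lra zify.
Set Implicit Arguments.
Unset Strict Implicit.
Unset Printing Implicit Defensive.
Import Order.TTheory GRing.Theory Num.Theory.
Import numFieldNormedType.Exports.
Local Open Scope classical_set_scope.
Local Open Scope ring_scope.

(** * Increasing sequences of sample points *)

Section Chains.
Context {R : realType} {n : nat}.
Implicit Types (X : n.-tuple (R * R)) (S : {set 'I_n}).

Lemma coord_rank_lt (f : 'I_n -> R) i j : (coord_rank f i < coord_rank f j)%N = (f i < f j).
Proof.
have mono k l : f k < f l -> (coord_rank f k < coord_rank f l)%N.
  move=> kl; apply: proper_card; apply/properP; split.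
    by apply/fintype.subsetP => m; rewrite !inE => /lt_trans; apply.
  by exists k; rewrite !inE ?ltxx.
apply/idP/idP => [|/mono//]; case: (ltP (f i) (f j)) => //.
rewrite le_eqVlt => /orP[/eqP ji|/mono/ltn_trans/[apply]]; last by rewrite ltnn.
suff -> : coord_rank f i = coord_rank f j by rewrite ltnn.
by apply/val_inj; apply: eq_card => k; rewrite !inE ji.
Qed.

(** An increasing subsequence is recorded as an unordered set of sample indices, so that the
    counting below concerns points of the plane and not ranks. *)
Definition chain X S : Prop :=
  {in S &, forall i j, xcoord X i < xcoord X j -> ycoord X i < ycoord X j}.

Lemma LIS_le_size (s : 'S_n) : (LIS s <= n)%N.
Proof. by apply/bigmax_leqP => k _; rewrite -ltnS. Qed.

(** Pulling the positions of an increasing subsequence back through the bijection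
    [coord_rank (xcoord X)] yields a chain with as many elements. *)
Lemma LIS_le X (b : nat) : injective (xcoord X) -> injective (ycoord X) ->
  (forall S, chain X S -> (#|S| <= b)%N) -> (LIS (Perm_points X) <= b)%N.
Proof.
move=> xinj yinj Sb; apply/bigmax_leqP => -[k kn] /existsP[/= i /forallP iP].
have {iP} iP (a c : 'I_k) : (a < c)%N -> (i a < i c)%N /\
    (Perm_points X (i a) < Perm_points X (i c))%N.
  by move=> ac; have /forallP/(_ c)/implyP/(_ ac)/andP := iP a.
have iinj : injective i.
  move=> a c eac; apply/val_inj; case: (ltngtP a c) => // /iP[]; by rewrite eac ltnn.
have [g gK Kg] := injF_bij (coord_rank_inj xinj).
have hinj : injective (g \o i) by exact/inj_comp/iinj/(can_inj Kg).
rewrite -[k]card_ord -(card_imset _ hinj); apply: Sb => p q.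
move=> /imsetP[a _ ->] /imsetP[c _ ->] /=.
rewrite -!coord_rank_lt !Kg => iac.
have ac : (a < c)%N.
  rewrite ltnNge leq_eqVlt; apply/negP => /orP[/eqP/val_inj ca|/iP[ica _]].
    by rewrite ca ltnn in iac.
  by have := ltn_trans iac ica; rewrite ltnn.
by have [_] := iP _ _ ac; rewrite -{1}[i a]Kg -{1}[i c]Kg !Perm_pointsE.
Qed.

(** The x-ranks of the indices in [S], listed in increasing order, are the positions of an
    increasing subsequence. *)
Lemma le_LIS X S : injective (xcoord X) -> injective (ycoord X) -> chain X S ->
  (#|S| <= LIS (Perm_points X))%N.
Proof.
move=> xinj yinj cS; set T := [set coord_rank (xcoord X) i | i in S]%SET.
have <- : #|T| = #|S| by rewrite card_imset//; exact: coord_rank_inj.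
have Tn : (#|T| < n.+1)%N by rewrite ltnS -[X in (_ <= X)%N]card_ord max_card.
rewrite /LIS; apply: (leq_bigmax_cond (Ordinal Tn)).
apply/existsP; exists [ffun a => enum_val a]; apply/forallP => /= a.
apply/forallP => c; apply/implyP => ac; rewrite !ffunE.
(* [enum T] filters the increasing list of all ordinals, so [enum_val] is increasing. *)
have st : sorted (fun u v : 'I_n => (u < v)%N) (enum T).
  apply: sorted_filter; first by move=> u v w; exact: ltn_trans.
  by rewrite -enumT -(@sorted_map _ _ val ltn) val_enum_ord iota_ltn_sorted.
have iac : (enum_val a < enum_val c)%N.
  have /= := @sorted_ltn_nth _ _ _ (enum_val a) _ st a c.
  by rewrite -!enum_val_nth !inE -!cardE !ltn_ord; apply => // u v w; exact: ltn_trans.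
rewrite iac /=.
have /imsetP[p pS pE] := enum_valP a; have /imsetP[q qS qE] := enum_valP c.
by move: iac; rewrite pE qE !Perm_pointsE// !coord_rank_lt; exact: cS.
Qed.

(* Along a chain [f x + g y] is nondecreasing, so the points of a chain on which it
   takes a given value all lie in one cell of the grid; there are [2M+1] values. *)
Lemma chain_card_cells X S (f g : R -> nat) (M : nat) (G : set R) (B : R) :
  {in G &, {homo f : x y / x <= y >-> (x <= y)%N}} ->
  {in G &, {homo g : x y / x <= y >-> (x <= y)%N}} ->
  (forall x, G x -> (f x <= M)%N /\ (g x <= M)%N) ->
  0 <= B ->
  (forall k l, (k <= M)%N -> (l <= M)%N ->
    #|[set i | [&& xcoord X i \in G, ycoord X i \in G, f (xcoord X i) == k &
      g (ycoord X i) == l]]%SET|%:R <= B) ->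
  injective (xcoord X) -> chain X S ->
  (#|S|)%:R <= #|[set i | (xcoord X i \notin G) || (ycoord X i \notin G)]%SET|%:R
    + (M.*2.+1)%:R * B.
Proof.
move=> fh gh fgM B0 cB xinj cS.
set bad := [set i | _ || _]%SET.
pose h i := (f (xcoord X i) + g (ycoord X i))%N.
have goodP i : i \in S :\: bad -> [/\ i \in S, G (xcoord X i) & G (ycoord X i)].
  rewrite !inE negb_or !negbK => /andP[/andP[+ +] iS]; rewrite !inE.
  by split.
have hM i : i \in S :\: bad -> (h i < M.*2.+1)%N.
  move=> /goodP[_ /fgM[fx _] /fgM[_ gy]].
  by rewrite ltnS -addnn leq_add.
rewrite (le_trans (_ : _ <= (#|S :&: bad| + #|S :\: bad|)%:R))//.
  by rewrite cardsID.
rewrite natrD lerD//; first by rewrite ler_nat subset_leq_card// finset.subsetIr.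
have -> : #|S :\: bad| = (\sum_(s < M.*2.+1) #|[set i in S :\: bad | h i == s]%SET|)%N.
  (* By [hM] no value of [h] on these indices falls back on the default of [inord], so the fibres
     are those of [h]. *)
  rewrite -sum1_card (partition_big (fun i => inord (h i) : 'I_(M.*2.+1)) xpredT)//=.
  apply: eq_bigr => s _; rewrite -sum1_card; apply: eq_bigl => i; rewrite inE.
  case: (boolP (i \in _)) => //= iS; apply/eqP/eqP => [<-|hs].
    by rewrite inordK// hM.
  by apply/val_inj; rewrite /= inordK// hM.
have -> : (M.*2.+1)%:R * B = \sum_(s < M.*2.+1) B.
  by rewrite sumr_const card_ord mulr_natl.
rewrite natr_sum; apply: ler_sum => s _.
set T := [set i in _ | _]%SET.
have [->|[i0]] := set_0Vmem T; first by rewrite cards0.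
rewrite inE => /andP[i0S /eqP hi0].
have [i0S' Gx0 Gy0] := goodP _ i0S; have [fx0 _] := fgM _ Gx0; have [_ gy0] := fgM _ Gy0.
apply: le_trans (cB (f (xcoord X i0)) (g (ycoord X i0)) fx0 gy0).
rewrite ler_nat; apply/subset_leq_card/fintype.subsetP => i.
rewrite inE => /andP[iS /eqP hi]; have [iS' Gx Gy] := goodP _ iS.
rewrite !inE !mem_set//=.
have [ij|ji|/xinj->] := ltgtP (xcoord X i) (xcoord X i0); last by rewrite !eqxx.
  have yy := cS _ _ iS' i0S' ij.
  have := fh _ _ (mem_set Gx) (mem_set Gx0) (ltW ij).
  have := gh _ _ (mem_set Gy) (mem_set Gy0) (ltW yy).
  by move: hi hi0; rewrite /h; lia.
have yy := cS _ _ i0S' iS' ji.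
have := fh _ _ (mem_set Gx0) (mem_set Gx) (ltW ji).
have := gh _ _ (mem_set Gy0) (mem_set Gy) (ltW yy).
by move: hi hi0; rewrite /h; lia.
Qed.

(** One sample point from each nonempty box gives a chain, since the boxes increase in both
    coordinates. *)
Lemma LIS_ge_boxes X (m : nat) (A : 'I_m -> set (R * R)) :
  (forall (k l : 'I_m) p q, (k < l)%N -> A k p -> A l q -> p.1 < q.1 /\ p.2 < q.2) ->
  injective (xcoord X) -> injective (ycoord X) ->
  (\sum_(k < m) `[< exists i, A k (tnth X i) >] <= LIS (Perm_points X))%N.
Proof.
move=> Alt xinj yinj.
(* The default index [i0] below requires a nonempty sample. *)
have [n0|n0] : n = 0%N \/ (0 < n)%N by case: (n) => [|n']; [left|right].
  rewrite big1// => k _; case: asboolP => // -[[i ilt] _].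
  by exfalso; rewrite n0 in ilt.
pose i0 := Ordinal n0.
pose r k := odflt i0 [pick i | `[< A k (tnth X i) >]].
pose K := [set k | `[< exists i, A k (tnth X i) >]]%SET.
have rK k : k \in K -> A k (tnth X (r k)).
  rewrite inE /r => /asboolP[i Ai]; case: pickP => [j /asboolP//|/(_ i)].
  by move/asboolP.
have rinj : {in K &, injective r}.
  move=> k l kK lK rkl; apply/val_inj; case: (ltngtP k l) => // kl.
    by have [] := Alt _ _ _ _ kl (rK _ kK) (rK _ lK); rewrite rkl ltxx.
  by have [] := Alt _ _ _ _ kl (rK _ lK) (rK _ kK); rewrite rkl ltxx.
have -> : (\sum_(k < m) `[< exists i, A k (tnth X i) >])%N = #|(r @: K)%SET|.
  rewrite card_in_imset// -sum1_card [RHS]big_mkcond; apply: eq_bigr => k _.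
  by rewrite inE; case: ifP.
apply: le_LIS => // _ _ /imsetP[k kK ->] /imsetP[l lK ->].
case: (ltngtP k l) => [kl _|kl|/val_inj->]; last by rewrite ltxx.
  by have [] := Alt _ _ _ _ kl (rK _ kK) (rK _ lK).
by rewrite ltNge ltW//; have [] := Alt _ _ _ _ kl (rK _ lK) (rK _ kK).
Qed.

End Chains.

(** * Independent samples *)

Section IidLaw.
Context {d : measure_display} {T : measurableType d} {R : realType}.
Variable mu : probability T R.
Local Open Scope ereal_scope.

Lemma measurable_tnth_preimage n (i : 'I_n) (A : set T) : measurable A ->
  measurable [set X : n.-tuple T | A (tnth X i)].
Proof.
by move=> mA; rewrite -[X in measurable X]setTI; exact: (measurable_tnth i measurableT mA).
Qed.

Lemma measurable_tnth_eq n (f : T -> R) (i j : 'I_n) : measurable_fun setT f ->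
  measurable [set X : n.-tuple T | f (tnth X i) = f (tnth X j)].
Proof.
move=> mf; have mtrue : measurable [set true] by [].
have /(_ measurableT _ mtrue) : measurable_fun setT
    (fun X : n.-tuple T => f (tnth X i) == f (tnth X j)).
  by apply: measurable_fun_eqr; apply: measurableT_comp => //; exact: measurable_tnth.
by rewrite setTI; congr measurable; apply/seteqP; split => X /= /eqP.
Qed.

(** The event is a box all of whose sides except the [i]-th are the whole space. *)
Lemma iid_law_tnth n (i : 'I_n) (A : set T) : measurable A ->
  iid_law mu n [set X | A (tnth X i)] = mu A.
Proof.
move=> mA; pose B (k : 'I_n) := if k == i then A else setT.
have mB k : measurable (B k) by rewrite /B; case: ifP.
transitivity (\prod_(k < n) mu (B k)).
  rewrite -(iid_law_box mu mB); congr (iid_law mu n _).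
  apply/seteqP; split => X /= H; last by have := H i; rewrite /B eqxx.
  by move=> k; rewrite /B; case: eqP => [->|].
rewrite (bigD1 i)//= big1; first by rewrite mule1 /B eqxx.
by move=> k /negPf ki; rewrite /B ki probability_setT.
Qed.

Lemma ge0_integral_iid_lawS n (F : n.+1.-tuple T -> \bar R) :
  measurable_fun setT F -> (forall X, 0 <= F X) ->
  \int[iid_law mu n.+1]_X F X = \int[mu]_x \int[iid_law mu n]_X F (tuple_cons (x, X)).
Proof.
move=> mF F0; rewrite /= ge0_integral_distribution//.
rewrite fubini_tonelli1//.
  by apply: measurableT_comp => //; exact: measurable_tuple_cons.
by move=> x; exact: F0.
Qed.

(** Independence in the form needed for exponential moments; induction on [n], splitting off the
    first point by Tonelli. *)
Lemma iid_law_prod n (f : T -> R) : measurable_fun setT f -> (forall x, (0 <= f x)%R) ->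
  \int[iid_law mu n]_X (\prod_(i < n) f (tnth X i))%:E = (\int[mu]_x (f x)%:E) ^+ n.
Proof.
move=> mf f0; elim: n => [|n IH].
  under eq_integral do rewrite big_ord0.
  by rewrite integral_cst//= diracT mule1.
have mprod m : measurable_fun setT (fun X : m.-tuple T => (\prod_(i < m) f (tnth X i))%:E).
  apply/measurable_EFinP; apply: measurable_prod => i _.
  by apply: measurableT_comp => //; exact: measurable_tnth.
rewrite ge0_integral_iid_lawS//; last first.
  by move=> X; rewrite lee_fin prodr_ge0.
have inner x : \int[iid_law mu n]_X (\prod_(i < n.+1) f (tnth (tuple_cons (x, X)) i))%:E
    = (f x)%:E * (\int[mu]_x (f x)%:E) ^+ n.
  rewrite -IH -ge0_integralZl//; last 3 first.
  - exact: mprod.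
  - by move=> X _; rewrite lee_fin prodr_ge0.
  - by rewrite lee_fin.
  apply: eq_integral => X _; rewrite big_ord_recl tnth0 -EFinM.
  by under eq_bigr do rewrite tnthS.
under eq_integral do rewrite inner.
rewrite ge0_integralZr//; last 3 first.
- by apply/measurable_EFinP.
- by move=> x _; rewrite lee_fin.
- by apply: expe_ge0; apply: integral_ge0 => x _; rewrite lee_fin.
by rewrite expeS.
Qed.

(** Induction on [n] with [i <= j]. If both indices are positive, the event concerns the tail only.
    If [i] is the first index, fixing the first point [x] leaves the event that a later point lies
    in the null set where [f] equals [f x]; Tonelli concludes. *)
Lemma iid_law_diagonal n (f : T -> R) (i j : 'I_n) : measurable_fun setT f ->
  (forall a, mu (f @^-1` [set a]) = 0) -> i != j ->
  iid_law mu n [set X | f (tnth X i) = f (tnth X j)] = 0.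
Proof.
move=> mf mf0; elim: n i j => [[]//|n IH] i j ij.
have mfa a : measurable (f @^-1` [set a]).
  by rewrite -[X in measurable X]setTI; exact: mf.
rewrite /= /distribution /pushforward.
wlog ilej : i j ij / (i <= j)%N.
  move=> W; case/orP: (leq_total i j) => [|ji]; first exact: W.
  rewrite -[RHS](W j i) 1?eq_sym//; congr (product_measure1 _ _ _).
  by apply/seteqP; split => x /= ->.
have [j' jE|jE] := unliftP ord0 j; last first.
  by move: ij ilej; rewrite jE -val_eqE leqn0 => /negPf /= ->.
have [i' iE|iE] := unliftP ord0 i.
  rewrite (_ : _ @^-1` _ = setT `*` [set X : n.-tuple T | f (tnth X i') = f (tnth X j')]).
    rewrite product_measure1E//; last exact: measurable_tnth_eq.
    rewrite -[RHS](mule0 (mu setT)); congr (_ * _); apply: IH.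
    by apply: contra_neq ij => ij'; rewrite iE jE ij'.
  by apply/seteqP; split => -[x X] /=; rewrite iE jE /tuple_cons !tnthS => // -[].
rewrite /product_measure1 integral0_eq// => x _ /=.
transitivity (iid_law mu n [set X | (f @^-1` [set f x]) (tnth X j')]).
  congr (iid_law mu n _); apply/seteqP; split => X;
  by rewrite /xsection/= in_setE/= iE jE /tuple_cons tnthS tnth0.
by rewrite iid_law_tnth.
Qed.

End IidLaw.

(** * Measurability, almost sure distinctness of coordinates, and moments of cell counts *)

Section ExpectedLIS.
Context {R : realType}.
Variable mu : probability (R * R)%type R.
Variable N : nat.

Lemma measurable_LIS :
  measurable_fun setT (fun X : N.-tuple (R * R) => (LIS (Perm_points X))%:R : R).
Proof.
rewrite (_ : (fun X => _) =
    fun X => \sum_(s : 'S_N) (LIS s)%:R * \1_[set X | Perm_points X = s] X).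
  apply: measurable_sum => s; apply: measurable_funM => //.
  by apply: measurable_indic; exact: measurable_Perm_points.
apply/funext => X; rewrite (bigD1 (Perm_points X))//= big1 => [|s sX].
  by rewrite indicE mem_set// mulr1 addr0.
by rewrite indicE memNset ?mulr0//= => /esym/eqP; rewrite (negPf sX).
Qed.

(** Ties lie in finitely many diagonals, each null because the marginals have no atoms. *)
Lemma ae_injective_coord : pre_permuton mu ->
  {ae iid_law mu N, forall X, injective (xcoord X) /\ injective (ycoord X)}.
Proof.
move=> [_ mu0].
pose D (f : R * R -> R) (i j : 'I_N) := [set X : N.-tuple (R * R) | f (tnth X i) = f (tnth X j)].
have nD (f : R * R -> R) : measurable_fun setT f -> (forall a, mu (f @^-1` [set a]) = 0%E) ->
    {ae iid_law mu N, forall X : N.-tuple (R * R), injective (fun i => f (tnth X i))}.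
  move=> mf mf0; pose E := \big[setU/set0]_(ij : 'I_N * 'I_N | ij.1 != ij.2) D f ij.1 ij.2.
  have mD i j : measurable (D f i j) by exact: measurable_tnth_eq.
  have nE : (iid_law mu N).-negligible E.
    rewrite /E; elim/big_ind : _ => [|A B|[i j] ij]; first exact: negligible_set0.
      exact: negligibleU.
    by exists (D f i j); split => //; exact: iid_law_diagonal.
  apply: negligibleS nE.
  move=> X /= /existsNP[i /existsNP[j /not_implyP[fij /eqP ij]]].
  by rewrite /E (bigD1 (i, j))//=; left.
have nx : {ae iid_law mu N, forall X : N.-tuple (R * R), injective (xcoord X)}.
  apply: (nD fst) => // a; rewrite -(mu0 a).1; congr (mu _).
  by apply/seteqP; split => -[x y] //= [].
have ny : {ae iid_law mu N, forall X : N.-tuple (R * R), injective (ycoord X)}.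
  apply: (nD snd) => // a; rewrite -(mu0 a).2; congr (mu _).
  by apply/seteqP; split => -[x y] //= [].
by apply: filterS2 nx ny.
Qed.

(** Written as a sum of indicators rather than as a cardinality (see [hitsE]), so that its mean is
    linear and its exponential is a product over the sample. *)
Definition hits (A : set (R * R)) (X : N.-tuple (R * R)) : R := \sum_(i < N) \1_A (tnth X i).

Lemma hitsE A X : hits A X = #|[set i | tnth X i \in A]%SET|%:R.
Proof.
rewrite /hits -sum1_card natr_sum [RHS]big_mkcond/=.
by apply: eq_bigr => i _; rewrite inE indicE; case: (_ \in _).
Qed.

Lemma measurable_hits A : measurable A -> measurable_fun setT (hits A).
Proof.
move=> mA; apply: measurable_sum => i.
by apply: measurableT_comp; [exact: measurable_indic|exact: measurable_tnth].
Qed.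

Lemma hits_ge0 A X : 0 <= hits A X.
Proof. by apply: sumr_ge0 => i _; rewrite indicE. Qed.

Lemma integral_hits A : measurable A ->
  (\int[iid_law mu N]_X (hits A X)%:E = N%:R%:E * mu A)%E.
Proof.
move=> mA; under eq_integral do rewrite /hits -sumEFin.
rewrite ge0_integral_sum//; last first.
  move=> i; apply/measurable_EFinP.
  by apply: measurableT_comp; [exact: measurable_indic|exact: measurable_tnth].
transitivity (\sum_(i < N) mu A)%E; last first.
  by rewrite -(fineK (fin_num_measure mu A mA)) -EFinM sumEFin sumr_const card_ord mulr_natl.
apply: eq_bigr => i _.
rewrite -(iid_law_tnth mu i mA) -[in RHS](setIT [set X | _]) -integral_indic//.
exact: measurable_tnth_preimage.
Qed.

(** The moment equals [(1 + (e - 1) * mu A) ^ N] by independence, and [1 + z <= expR z]. *)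
Lemma integral_expR_hits A (delta : R) : measurable A -> (mu A <= delta%:E)%E ->
  (\int[iid_law mu N]_X (expR (hits A X))%:E <= (expR ((expR 1 - 1) * (delta * N%:R)))%:E)%E.
Proof.
move=> mA muA; under eq_integral do rewrite /hits expR_sum.
rewrite (iid_law_prod mu N (f := fun p => expR (\1_A p)))//; last first.
  by apply: measurableT_comp => //; exact: measurable_indic.
have e1 : 0 <= expR 1 - 1 :> R by rewrite subr_ge0 -expR0 ler_expR.
have -> : (\int[mu]_p (expR (\1_A p))%:E = 1 + (expR 1 - 1)%:E * mu A)%E.
  transitivity (\int[mu]_p (1 + (expR 1 - 1)%:E * (\1_A p)%:E))%E.
    apply: eq_integral => p _; rewrite indicE -EFinM -EFinD; congr EFin.
    by case: (_ \in _); rewrite ?mulr1 ?mulr0 ?addr0 ?expR0 // addrC subrK.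
  rewrite ge0_integralD//; last first.
    by apply/measurable_EFinP; apply: measurable_funM => //; exact: measurable_indic.
  rewrite integral_cst//= probability_setT mule1 ge0_integralZl//; last first.
    by apply/measurable_EFinP; exact: measurable_indic.
  by rewrite integral_indic// setIT.
have muA0 : (0 <= mu A)%E by [].
have H : (1 + (expR 1 - 1)%:E * mu A <= (expR ((expR 1 - 1) * delta))%:E)%E.
  apply: (@le_trans _ _ (1 + (expR 1 - 1) * delta)%:E); last by rewrite lee_fin expR_ge1Dx.
  by rewrite (EFinD 1) (EFinM _ delta) leeD2l// lee_wpmul2l// lee_fin.
rewrite mulrA expRM_natr; elim: (N) => [|n IH]; first by rewrite expr0.
rewrite expeS exprS EFinM lee_pmul//.
  by rewrite adde_ge0// mule_ge0// lee_fin.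
by apply: expe_ge0; rewrite adde_ge0// mule_ge0// lee_fin.
Qed.

End ExpectedLIS.

(** * General upper and lower bounds on the expected length for a pre-permuton *)

Section ExpectedLISBounds.
Context {R : realType}.
Variable mu : probability (R * R)%type R.
Variable N : nat.
Hypothesis hmu : pre_permuton mu.

(** [expected_LIS_Sample] applies [fine], which is faithful only on finite values; here the length
    is at most [N]. *)
Lemma expectation_LIS_fin_num :
  ('E_(iid_law mu N)[fun X => (LIS (Perm_points X))%:R] \is a fin_num)%E.
Proof.
rewrite ge0_fin_numE; last by apply: expectation_ge0 => X.
apply: (@le_lt_trans _ _ 'E_(iid_law mu N)[cst N%:R]%E); last first.
  by rewrite expectation_cst ltry.
apply: expectation_le => //.
- exact: measurable_LIS.
- by apply: aeW => X /=; rewrite ler_nat LIS_le_size.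
Qed.

(* The number [u] of points in a cell is bounded by [L + expR (u - L)], so that the
   largest cell count is at most [L] plus [expR (- L)] times the sum of all [expR u],
   whose expectation factorizes. *)
Lemma expected_LIS_le (f : R -> nat) (M : nat) (G : set R) (delta eta L : R) :
  {in G &, {homo f : x y / x <= y >-> (x <= y)%N}} ->
  (forall x, G x -> (f x <= M)%N) ->
  measurable G -> (forall k, measurable (G `&` f @^-1` [set k])) -> 0 <= L ->
  (forall k l, (mu ((G `&` f @^-1` [set k]) `*` (G `&` f @^-1` [set l])) <= delta%:E)%E) ->
  (mu (~` (G `*` G)) <= eta%:E)%E ->
  expected_LIS_Sample mu N <= N%:R * eta +
    (M.*2.+1)%:R * (L + expR (- L) * ((M.+1 ^ 2)%:R * expR ((expR 1 - 1) * (delta * N%:R)))).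
Proof.
move=> fh fM mG mGf L0 mucell mubad.
pose J k l : set (R * R) := (G `&` f @^-1` [set k]) `*` (G `&` f @^-1` [set l]).
have mJ k l : measurable (J k l) by apply: measurableX.
have mbad : measurable (~` (G `*` G)) by apply: measurableC; exact: measurableX.
pose W (X : N.-tuple (R * R)) : R := \sum_(k < M.+1) \sum_(l < M.+1) expR (hits (J k l) X).
have W0 X : 0 <= W X by apply: sumr_ge0 => k _; apply: sumr_ge0 => l _; exact: expR_ge0.
have mW : measurable_fun setT W.
  apply: measurable_sum => k; apply: measurable_sum => l.
  by apply: measurableT_comp => //; exact: measurable_hits.
pose c := (M.*2.+1)%:R * expR (- L).
have c0 : 0 <= c by rewrite mulr_ge0// expR_ge0.
pose U X := hits (~` (G `*` G)) X + ((M.*2.+1)%:R * L + c * W X).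
have LU : {ae iid_law mu N, forall X, (LIS (Perm_points X))%:R <= U X}.
  apply: filterS (ae_injective_coord N hmu) => X [xinj yinj].
  have U0 : 0 <= U X.
    by rewrite addr_ge0 ?hits_ge0// addr_ge0// mulr_ge0.
  (* [LIS_le] takes a natural number as bound, so the real bound [U X] is truncated first. *)
  apply: le_trans (_ : (Num.truncn (U X))%:R <= _); last by rewrite truncn_le.
  rewrite ler_nat; apply: LIS_le => // S cS; rewrite truncn_ge_nat//.
  have B0 : 0 <= L + expR (- L) * W X by rewrite addr_ge0// mulr_ge0 ?expR_ge0.
  apply: le_trans (chain_card_cells (M := M) fh fh _ B0 _ xinj cS) _.
  - by move=> x Gx; rewrite fM.
  - move=> k l kM lM.
    have -> : #|[set i | [&& xcoord X i \in G, ycoord X i \in G, f (xcoord X i) == k &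
        f (ycoord X i) == l]]%SET|%:R = hits (J k l) X.
      rewrite hitsE; congr (_%:R); apply: eq_card => i; rewrite !inE.
      apply/idP/idP.
        by move=> /and4P[/set_mem ? /set_mem ? /eqP ? /eqP ?]; rewrite mem_set.
      by move=> /set_mem[[/= ? <-] [/= ? <-]]; rewrite !eqxx !mem_set.
    have h1 : hits (J k l) X - L <= expR (hits (J k l) X - L).
      by apply: le_trans (expR_ge1Dx _); rewrite lerDr.
    have h2 : expR (hits (J k l) X) <= W X.
      rewrite /W (bigD1 (Ordinal (_ : k < M.+1)%N))//= (bigD1 (Ordinal (_ : l < M.+1)%N))//=.
      rewrite -addrA lerDl addr_ge0//.
        by apply: sumr_ge0 => ? _; exact: expR_ge0.
      by apply: sumr_ge0 => ? _; apply: sumr_ge0 => ? _; exact: expR_ge0.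
    rewrite -lerBlDl (le_trans h1)// addrC expRD ler_wpM2l// expR_ge0//.
  - rewrite /U hitsE lerD//.
      rewrite ler_nat subset_leq_card//; apply/fintype.subsetP => i; rewrite !inE.
      move=> H -[/= /mem_set Gx /mem_set Gy].
      by move: H; rewrite /xcoord Gx /ycoord Gy.
    by rewrite mulrDr mulrA.
have cst_ge0 : 0 <= (M.*2.+1)%:R * L by rewrite mulr_ge0.
rewrite /expected_LIS_Sample -lee_fin fineK; last exact: expectation_LIS_fin_num.
apply: (@le_trans _ _ 'E_(iid_law mu N)[U]%E).
  apply: expectation_le => //.
  - exact: measurable_LIS.
  - apply: measurable_funD; first exact: measurable_hits.
    by apply: measurable_funD => //; apply: measurable_funM.
  - by move=> X; rewrite addr_ge0 ?hits_ge0// addr_ge0// mulr_ge0.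
rewrite unlock.
have -> : (\int[iid_law mu N]_X (U X)%:E = N%:R%:E * mu (~` (G `*` G)) +
    (((M.*2.+1)%:R * L)%:E + c%:E * \int[iid_law mu N]_X (W X)%:E))%E.
  under eq_integral do rewrite EFinD.
  have mcW : measurable_fun setT (fun X => c * W X) by exact: measurable_funM.
  rewrite ge0_integralD//; last 4 first.
  - by move=> X _; rewrite lee_fin hits_ge0.
  - by apply/measurable_EFinP; exact: measurable_hits.
  - by move=> X _; rewrite lee_fin addr_ge0// mulr_ge0.
  - by apply/measurable_EFinP; exact: measurable_funD.
  rewrite integral_hits//; congr (_ + _)%E.
  under eq_integral do rewrite EFinD.
  rewrite ge0_integralD//; last 2 first.
  - by move=> X _; rewrite lee_fin mulr_ge0.
  - exact/measurable_EFinP.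
  rewrite integral_cst//= probability_setT mule1; congr (_ + _)%E.
  under eq_integral do rewrite EFinM.
  rewrite ge0_integralZl//; first exact/measurable_EFinP.
  by move=> X _; rewrite lee_fin.
have Wle : (\int[iid_law mu N]_X (W X)%:E <=
    ((M.+1 ^ 2)%:R * expR ((expR 1 - 1) * (delta * N%:R)))%:E)%E.
  set r := expR _.
  apply: (@le_trans _ _ (\sum_(k < M.+1) \sum_(l < M.+1) r%:E)%E); last first.
    under eq_bigr do rewrite sumEFin sumr_const card_ord.
    rewrite sumEFin sumr_const card_ord -mulrnA lee_fin mulr_natl.
    by rewrite mulnn.
  under eq_integral do rewrite -sumEFin.
  rewrite ge0_integral_sum//; last 2 first.
  - move=> k; apply/measurable_EFinP; apply: measurable_sum => l.
    by apply: measurableT_comp => //; exact: measurable_hits.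
  - by move=> k X _; rewrite lee_fin; apply: sumr_ge0 => l _; exact: expR_ge0.
  apply: lee_sum => k _; under eq_integral do rewrite -sumEFin.
  rewrite ge0_integral_sum//; last first.
    move=> l; apply/measurable_EFinP.
    by apply: measurableT_comp => //; exact: measurable_hits.
  by apply: lee_sum => l _; apply: integral_expR_hits => //; exact: mucell.
rewrite mulrDr mulrA -/c EFinD (EFinD (_ * L)) (EFinM N%:R eta) (EFinM c).
by rewrite leeD ?lee_wpmul2l// leeD2l// lee_wpmul2l// lee_fin.
Qed.

(** A box of mass at least [p] is missed by the whole sample with probability at most
    [(1 - p) ^ N <= expR (- (p * N))]. The length is at least the number of boxes hit, whose mean is
    the sum of the hitting probabilities. *)
Lemma expected_LIS_ge (m : nat) (A : 'I_m -> set (R * R)) (p : R) :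
  (forall k, measurable (A k)) ->
  (forall (k l : 'I_m) u v, (k < l)%N -> A k u -> A l v -> u.1 < v.1 /\ u.2 < v.2) ->
  (forall k, (p%:E <= mu (A k))%E) ->
  m%:R * (1 - expR (- (p * N%:R))) <= expected_LIS_Sample mu N.
Proof.
move=> mA Alt muA.
pose E k := [set X : N.-tuple (R * R) | exists i, A k (tnth X i)].
have mE k : measurable (E k).
  rewrite (_ : E k = \big[setU/set0]_(i < N) [set X | A k (tnth X i)]).
    by apply: bigsetU_measurable => i _; exact: measurable_tnth_preimage.
  apply/seteqP; split => [X [i Ai]|X]; first by rewrite (bigD1 i)//=; left.
  elim/big_ind : _ => //= [B C + + []|i _ Ai]; [by move=> h _ /h|by move=> _ h /h|].
  by exists i.
have PE k : ((1 - expR (- (p * N%:R)))%:E <= iid_law mu N (E k))%E.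
  have -> : E k = ~` [set X | forall i, (~` A k) (tnth X i)].
    apply/seteqP; split => X /=; first by case=> i Ai /(_ i).
    by move=> /existsNP[i /contrapT]; exists i.
  have mNE : measurable [set X : N.-tuple (R * R) | forall i, (~` A k) (tnth X i)].
    rewrite (_ : [set _ | _] = ~` E k); first exact: measurableC.
    apply/seteqP; split => X /= H; first by case=> i /H.
    by move=> i Ai; apply: H; exists i.
  rewrite probability_setC// EFinB leeB// (iid_law_box mu (A := fun=> ~` A k)); last first.
    by move=> _; exact: measurableC.
  rewrite probability_setC//.
  have /fineK <- : mu (A k) \is a fin_num by exact: fin_num_measure.
  have := muA k; rewrite -{1}(fineK (fin_num_measure mu (A k) (mA k))) lee_fin => pA.
  have A1 : fine (mu (A k)) <= 1.
    by rewrite -lee_fin fineK ?fin_num_measure// probability_le1.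
  rewrite -EFinB prodEFin lee_fin prodr_const card_ord -mulNr expRM_natr.
  apply: lerXn2r; rewrite ?nnegrE ?subr_ge0 ?expR_ge0//.
  by apply: le_trans (expR_ge1Dx _); lra.
rewrite /expected_LIS_Sample -lee_fin fineK; last exact: expectation_LIS_fin_num.
pose Y (X : N.-tuple (R * R)) : R := \sum_(k < m) \1_(E k) X.
apply: (@le_trans _ _ 'E_(iid_law mu N)[Y]%E).
  rewrite unlock; under [leRHS]eq_integral do rewrite -sumEFin.
  rewrite ge0_integral_sum//; last first.
    by move=> k; apply/measurable_EFinP; exact: measurable_indic.
  rewrite (_ : m%:R * _ = \sum_(k < m) (1 - expR (- (p * N%:R)))); last first.
    by rewrite sumr_const card_ord mulr_natl.
  by rewrite -sumEFin; apply: lee_sum => k _; rewrite integral_indic// setIT; exact: PE.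
apply: expectation_le.
- by apply: measurable_sum => k; exact: measurable_indic.
- exact: measurable_LIS.
- by move=> X; apply: sumr_ge0 => k _; rewrite indicE.
- by [].
apply: filterS (ae_injective_coord N hmu) => X [xinj yinj].
apply: le_trans (_ : (\sum_(k < m) `[< exists i, A k (tnth X i) >])%N%:R <= _); last first.
  by rewrite ler_nat; exact: LIS_ge_boxes.
by rewrite natr_sum ler_sum.
Qed.

End ExpectedLISBounds.

(** * The density near the corner *)

Section Density.
Context {R : realType}.
Implicit Types (rho : @density R) (c g : R) (p : R * R).
Local Notation lebesgue2 := (@lebesgue_measure R \x @lebesgue_measure R)%E.

(** The comparison function of the theorem, with the negative exponent [beta / (1 - beta)] written
    [- g]. *)
Definition cusp c g p : R :=
  let d := `|p.1 - 1| + `|p.2 - 1| in d `^ (- g) * expR (- c * `|p.1 - p.2| * d `^ (- g)).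

Lemma cusp_ge0 c g p : 0 <= cusp c g p.
Proof. by rewrite mulr_ge0// ?powR_ge0 ?expR_ge0. Qed.

Lemma bounded_on_compact rho (C : set (R * R)) :
  {within unit_square `\ (1, 1), continuous rho} -> compact C -> C `<=` unit_square `\ (1, 1) ->
  exists2 K : R, 0 < K & forall p, C p -> rho p <= K.
Proof.
move=> crho cC CS.
have := continuous_compact (continuous_subspaceW CS crho) cC.
move=> /compact_bounded[K [Kreal HK]].
exists (`|K| + 1) => [|p Cp]; first by rewrite ltr_pwDr.
apply: le_trans (ler_norm _) (HK (`|K| + 1) _ _ _); last by exists p.
by rewrite (le_lt_trans (ler_norm K))// ltrDl.
Qed.

(** Near the corner both bounds are the asymptotic hypothesis. Elsewhere [rho] is bounded by
    compactness, which the summand 1 next to the cusp accounts for. *)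
Lemma density_cusp_bounds rho c g :
  {within unit_square `\ (1, 1), continuous rho} -> Theta_at_11 rho (cusp c g) ->
  exists K k e : R, [/\ 0 < K, 0 < k, 0 < e,
    forall p, unit_square p -> p != (1, 1) -> rho p <= K * (1 + cusp c g p) &
    forall p, unit_square p -> p != (1, 1) -> 1 - e < p.1 -> 1 - e < p.2 ->
      k * cusp c g p <= rho p].
Proof.
move=> crho [c1 [c2 [c10 c12 /nbhs_ballP[e /= e0 be]]]].
have c20 : 0 < c2 by exact: lt_le_trans c12.
have near11 p : unit_square p -> p != (1, 1) -> 1 - e < p.1 -> 1 - e < p.2 ->
    c1 * cusp c g p <= rho p <= c2 * cusp c g p.
  move=> Sp p1 ex ey; apply: be => //; move: p {p1} Sp ex ey => [x y] [/=].
  rewrite !in_itv/= => /andP[x0 x1] /andP[y0 y1] ex ey.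
  by split; rewrite /ball /= ger0_norm ?subr_ge0//; lra.
(* The part of the square with a coordinate at most [1 - e] is the union of two compact rectangles
   avoiding the corner (empty if [e > 1]). *)
pose C1 : set (R * R) := `[0, 1 - e]%classic `*` `[0, 1]%classic.
pose C2 : set (R * R) := `[0, 1]%classic `*` `[0, 1 - e]%classic.
have C1S : C1 `<=` unit_square `\ (1, 1).
  move=> [x y] [/=]; rewrite !in_itv/= => /andP[x0 x1] y01; split.
    by split; rewrite /= in_itv//= x0 /= (le_trans x1)// gerBl ltW.
  by case=> x1'; move: x1; rewrite x1'; lra.
have C2S : C2 `<=` unit_square `\ (1, 1).
  move=> [x y] [/=]; rewrite !in_itv/= => x01 /andP[y0 y1]; split.
    by split; rewrite /= in_itv//= y0 /= (le_trans y1)// gerBl ltW.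
  by case=> _ y1'; move: y1; rewrite y1'; lra.
have [K1 K10 HK1] := bounded_on_compact crho
  (compact_setX (@segment_compact R 0 (1 - e)) (@segment_compact R 0 1)) C1S.
have [K2 K20 HK2] := bounded_on_compact crho
  (compact_setX (@segment_compact R 0 1) (@segment_compact R 0 (1 - e))) C2S.
exists (K1 + K2 + c2), c1, e; split => //.
- by rewrite !addr_gt0.
- move=> p Sp p1; have D0 := cusp_ge0 c g p.
  have [x1|x1] := leP p.1 (1 - e).
    have : rho p <= K1.
      apply: HK1; move: Sp x1; case: p {p1 D0} => x y [/=].
      by rewrite !in_itv/= => /andP[x0 _] y01 xe; split; rewrite /= ?in_itv/= ?x0 ?xe.
    by nra.
  have [y1|y1] := leP p.2 (1 - e).
    have : rho p <= K2.
      apply: HK2; move: Sp y1; case: p {p1 x1 D0} => x y [/=].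
      by rewrite !in_itv/= => x01 /andP[y0 _] ye; split; rewrite /= ?in_itv/= ?y0 ?ye.
    by nra.
  have /andP[_] := near11 p Sp p1 x1 y1.
  by nra.
- move=> p Sp p1 x1 y1.
  by have /andP[] := near11 p Sp p1 x1 y1.
Qed.

Lemma mu_box_le rho (A : set (R * R)) (a b a' b' B : R) : measurable A ->
  a <= b -> a' <= b' -> 0 <= B ->
  A `<=` `[a, b]%classic `*` `[a', b']%classic ->
  (forall p, A p -> unit_square p -> rho p <= B) ->
  (mu_ rho A <= (B * ((b - a) * (b' - a')))%:E)%E.
Proof.
move=> mA ab ab' B0 AI rB.
have mAs : measurable (A `&` unit_square).
  by apply: measurableI => //; exact: measurable_unit_square.
apply: (@le_trans _ _ (\int[lebesgue2]_(p in A `&` unit_square) (cst B%:E p))%E).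
  apply: ge0_le_integral => //.
  - by move=> p [_ Sp]; rewrite lee_fin density_ge0.
  - apply/measurable_EFinP; apply: (measurable_funS measurable_unit_square).
      by move=> p [].
    exact: density_measurable.
  - by move=> p [Ap Sp]; rewrite lee_fin rB.
rewrite integral_cst//= EFinM lee_wpmul2l//.
apply: (@le_trans _ _ (lebesgue2 (`[a, b]%classic `*` `[a', b']%classic))).
  apply: le_measure; rewrite ?inE//; first exact: measurableX.
  by apply: subset_trans AI => p [].
rewrite product_measure1E//= !lebesgue_measure_itv/= !lte_fin.
rewrite EFinM lee_pmul//; case: ifPn => //= _; rewrite ?lee_fin ?subr_ge0//.
Qed.

(** Half-open sides allow successive boxes to share a corner and still be strictly ordered in both
    coordinates. *)
Lemma mu_box_ge rho (a b a' b' B : R) :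
  a < b -> a' < b' -> 0 <= B ->
  `[a, b[%classic `*` `[a', b'[%classic `<=` (unit_square : set (R * R)) ->
  (forall p, (`[a, b[%classic `*` `[a', b'[%classic) p -> B <= rho p) ->
  ((B * ((b - a) * (b' - a')))%:E <= mu_ rho (`[a, b[%classic `*` `[a', b'[%classic))%E.
Proof.
move=> ab ab' B0 AS rB; rewrite /mu_ setIidl//.
have mA : measurable (`[a, b[%classic `*` `[a', b'[%classic : set (R * R)) by exact: measurableX.
apply: (@le_trans _ _ (\int[lebesgue2]_(p in `[a, b[%classic `*` `[a', b'[%classic)
    (cst B%:E p))%E).
  rewrite integral_cst//= product_measure1E//=.
  by rewrite !lebesgue_measure_itv/= !lte_fin ab ab' -!EFinB -!EFinM.
apply: ge0_le_integral => //.
- apply/measurable_EFinP; apply: (measurable_funS measurable_unit_square) => //.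
  exact: density_measurable.
Qed.

End Density.

Lemma powR_ge1 {R : realType} (x r : R) : 1 <= x -> 0 <= r -> 1 <= x `^ r.
Proof. by move=> x1 r0; rewrite -(powRr0 x) ler_powR. Qed.

(** * Pointwise bounds on the cusp, and the Laplace kernel *)

Section Cusp.
Context {R : realType}.
Implicit Types (c g : R) (p : R * R).

Lemma powRN_le (a b r : R) : 0 < a -> a <= b -> 0 <= r -> b `^ (- r) <= a `^ (- r).
Proof.
move=> a0 ab r0; have b0 := lt_le_trans a0 ab.
by rewrite !powRN lef_pV2 ?posrE ?powR_gt0// ge0_ler_powR ?nnegrE// ltW.
Qed.

(** The exponential is at most 1, and [t * t' <= (t + t') ^+ 2] is raised to the power [- (g / 2)].
    The product form lets the mass of a grid cell factorize. *)
Lemma cusp_le_prod c g p : 0 < c -> 0 < g -> p.1 < 1 -> p.2 < 1 ->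
  cusp c g p <= (1 - p.1) `^ (- (g / 2)) * (1 - p.2) `^ (- (g / 2)).
Proof.
move=> c0 g0 x1 y1; rewrite /cusp /=.
have t0 : 0 < 1 - p.1 by rewrite subr_gt0.
have t0' : 0 < 1 - p.2 by rewrite subr_gt0.
rewrite distrC (gtr0_norm t0) distrC (gtr0_norm t0').
set t := 1 - p.1 in t0 *; set t' := 1 - p.2 in t0' *.
apply: (@le_trans _ _ ((t + t') `^ (- g))).
  rewrite -[leRHS]mulr1 ler_wpM2l ?powR_ge0// -[leRHS]expR0 ler_expR.
  by rewrite !mulNr oppr_le0 !mulr_ge0 ?powR_ge0// ltW.
have d0 : 0 <= t + t' by rewrite addr_ge0// ltW.
rewrite -(powRM _ (ltW t0) (ltW t0')) (_ : - g = 2 * - (g / 2)); last by field.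
rewrite powRrM powR_mulrn//.
by apply: powRN_le; [rewrite mulr_gt0|nra|rewrite divr_ge0// ltW].
Qed.

(* Either [d <= 4t], and [d] is comparable with [t]; or [y] is far from the diagonal,
   [|x - y| >= d / 2], and [cusp] is at most [w ^ beta * exp (- c w / 2)] with
   [w = d ^ (1 - g)], which is bounded. *)
Lemma cusp_le_laplace c beta : 0 < c -> 1 < beta < 2 ->
  exists K k : R, [/\ 0 < K, 0 < k & forall p, p.1 < 1 -> p.2 <= 1 ->
    let a := k * (1 - p.1) `^ (- (beta / (beta - 1))) in
    cusp c (beta / (beta - 1)) p <= K * (1 + a * expR (- (a * `|p.1 - p.2|)))].
Proof.
move=> c0 /andP[b1 b2]; set g := beta / (beta - 1).
have bm1 : 0 < beta - 1 by rewrite subr_gt0.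
have g0 : 0 < g by rewrite divr_gt0// (lt_trans _ b1).
have bg : (1 - g) * beta = - g by rewrite /g; field; rewrite gt_eqF.
(* With this [k], [a] equals [c * (4 * t) ^ (- g)], hence is at most [c * d ^ (- g)] when
   [d <= 4 * t]. *)
pose k : R := c * 4 `^ (- g).
have k0 : 0 < k by rewrite mulr_gt0// powR_gt0.
(* [k^-1] serves the points with [d <= 4 * t]; [1 + 8 / c ^+ 2] bounds
   [(1 + w ^+ 2) * expR (- (c * w / 2))] for the others. *)
exists (k^-1 + 1 + 8 / c ^+ 2), k; split => //.
  by rewrite ltr_wpDr ?divr_ge0 ?exprn_ge0 ?addr_gt0 ?invr_gt0// ltW.
move=> [x y] /= x1 y1; rewrite /cusp /=.
have t0 : 0 < 1 - x by rewrite subr_gt0.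
have t0' : 0 <= 1 - y by rewrite subr_ge0.
rewrite (distrC x 1) (gtr0_norm t0) (distrC y 1) (ger0_norm t0').
have -> : x - y = (1 - y) - (1 - x) by ring.
set t := 1 - x in t0 *; set t' := 1 - y in t0' *.
set a := k * _; have a0 : 0 < a by rewrite mulr_gt0// powR_gt0.
have e0 z : 0 <= expR z :> R by exact: expR_ge0.
have c8 : 0 <= 8 / c ^+ 2 by rewrite divr_ge0 ?exprn_ge0 ?ltW.
have ki0 : 0 < k^-1 by rewrite invr_gt0.
have td : t <= t + t' by rewrite lerDl.
have [dt|td4] := leP (t + t') (4 * t).
  have h1 : (t + t') `^ (- g) <= k^-1 * a.
    by rewrite /a mulKf ?gt_eqF//; apply: powRN_le => //; exact: ltW.
  have h2 : a <= c * (t + t') `^ (- g).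
    rewrite /a /k -mulrA (ler_wpM2l (ltW c0))// -(powRM _ _ (ltW t0))//.
    by apply: powRN_le => //; [exact: lt_le_trans td|exact: ltW].
  have h3 : expR (- c * `|t' - t| * (t + t') `^ (- g)) <= expR (- (a * `|t' - t|)).
    by rewrite ler_expR mulrAC !mulNr lerN2 ler_wpM2r.
  apply: (@le_trans _ _ (k^-1 * a * expR (- (a * `|t' - t|)))).
    by apply: ler_pM => //; exact: powR_ge0.
  have ae : 0 <= a * expR (- (a * `|t' - t|)) by rewrite mulr_ge0// ltW.
  by rewrite -mulrA; nra.
have d0 : 0 < t + t' by exact: lt_le_trans td.
have u : (t + t') / 2 <= `|t' - t| by rewrite ger0_norm; lra.
(* With this exponent [d * d ^ (- g) = w], and [d ^ (- g) = w ^ beta] because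
   [(1 - g) * beta = - g]. *)
pose w := (t + t') `^ (1 - g).
have w0 : 0 < w by rewrite powR_gt0.
have dw : (t + t') `^ (- g) = w `^ beta by rewrite -bg powRrM.
have h1 : expR (- c * `|t' - t| * (t + t') `^ (- g)) <= expR (- (c * w / 2)).
  have -> : w = (t + t') * (t + t') `^ (- g).
    by rewrite /w powRD ?powRr1 ?(ltW d0)// (gt_eqF d0) implybT.
  rewrite ler_expR !mulNr lerN2 -!mulrA (ler_wpM2l (ltW c0))//.
  by rewrite (mulrC _ 2^-1) mulrA ler_wpM2r ?powR_ge0.
have h2 : w `^ beta <= 1 + w ^+ 2.
  have [w1|w1] := leP w 1.
    rewrite (le_trans (_ : _ <= 1))//; last by rewrite lerDl sqr_ge0.
    have : w `^ beta <= 1 `^ beta.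
      by apply: ge0_ler_powR; rewrite ?nnegrE ?(ltW w0)// ltW// (lt_trans _ b1).
    by rewrite powR1.
  rewrite (le_trans (_ : _ <= w ^+ 2))//; last by rewrite lerDr.
  by rewrite -(powR_mulrn _ (ltW w0)); apply: ler_powR; exact: ltW.
(* From [1 + z ^+ 2 / 2 <= expR z] at [z = c * w / 2]. *)
have h3 : w ^+ 2 <= 8 / c ^+ 2 * expR (c * w / 2).
  have cw0 : 0 <= c * w / 2 by rewrite divr_ge0// mulr_ge0 ?(ltW c0) ?(ltW w0).
  have := expR_ge1Dxn 1 cw0; rewrite (_ : 2`! = 2)%N// => h.
  rewrite -ler_pdivrMl ?divr_gt0 ?exprn_gt0//.
  apply: le_trans h; rewrite -[leLHS]add0r lerD// le_eqVlt; apply/orP; left; apply/eqP.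
  by field; rewrite gt_eqF.
rewrite [X in X * _ <= _]dw; apply: (@le_trans _ _ ((1 + w ^+ 2) * expR (- (c * w / 2)))).
  by apply: ler_pM => //; exact: powR_ge0.
have h4 : w ^+ 2 * expR (- (c * w / 2)) <= 8 / c ^+ 2.
  by rewrite expRN ler_pdivrMr ?expR_gt0.
have h5 : expR (- (c * w / 2)) <= 1.
  by rewrite -[leRHS]expR0 ler_expR oppr_le0 divr_ge0// mulr_ge0// ltW.
have ae : 0 <= a * expR (- (a * `|t' - t|)) by rewrite mulr_ge0// ltW.
by nra.
Qed.

(** The form of the coefficient covers both halves of the Laplace kernel: [k = 1], [r = a] on the
    left of [x] and [k = -1], [r = - a] on its right. *)
Lemma integral_expR_affine (k r x s e : R) : s < e ->
  (\int[lebesgue_measure]_(y in `[s, e]) (k * r * expR (r * (y - x)))%:E =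
   (k * expR (r * (e - x)) - k * expR (r * (s - x)))%:E)%E.
Proof.
move=> se; pose F y : R := k * expR (r * (y - x)).
have dF y : is_derive (y : R) 1 F (k * r * expR (r * (y - x))).
  apply: is_derive_eq; rewrite /GRing.scale/=; ring.
have cF : continuous F.
  by move=> y; apply: differentiable_continuous; apply/derivable1_diffP; exact: ex_derive.
have cf : continuous (fun y => k * r * expR (r * (y - x))).
  move=> y; have df : is_derive (y : R) 1 (fun y => k * r * expR (r * (y - x)))
      (k * r * r * expR (r * (y - x))).
    apply: is_derive_eq; rewrite /GRing.scale/=; ring.
  by apply: differentiable_continuous; apply/derivable1_diffP; exact: ex_derive.
rewrite (continuous_FTC2 (F := F))//.
- exact: continuous_subspaceT.
- split; first by move=> y _; exact: ex_derive.
  + by apply: cvg_at_right_filter; exact: cF.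
  + by apply: cvg_at_left_filter; exact: cF.
- by move=> y _; rewrite derive1E derive_val.
Qed.

(** The interval is enlarged to a unit interval on each side of [x]; each half contributes
    [1 - expR (- a)]. *)
Lemma integral_laplace_le (a x : R) : 0 < a -> 0 <= x <= 1 ->
  (\int[lebesgue_measure]_(y in `[0%R, 1%R]) (a * expR (- (a * `|x - y|)))%:E <= 2%:E)%E.
Proof.
move=> a0 /andP[x0 x1].
pose h y := (a * expR (- (a * `|x - y|)))%:E.
have h0 y : (0 <= h y)%E by rewrite lee_fin mulr_ge0 ?expR_ge0 ?ltW.
have mh (D : set R) : measurable_fun D h.
  apply/measurable_EFinP/measurable_funTS; apply: measurable_funM => //.
  apply: measurableT_comp => //; apply: measurableT_comp => //.
  apply: measurable_funM => //; apply: measurableT_comp => //.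
  exact: measurable_funB.
apply: (@le_trans _ _ (\int[lebesgue_measure]_(y in `[(x - 1)%R, x[ `|` `[x, (x + 1)%R]) h y)%E).
  apply: ge0_subset_integral => //; [exact: measurableU|exact: mh|by move=> *; exact: h0|].
  move=> y /=; rewrite !in_itv/= => /andP[y0 y1].
  by have [yx|xy] := ltP y x; [left|right]; apply/andP; split => //; lra.
rewrite ge0_integral_setU//; last 2 first.
- exact: mh.
- apply/disj_setPS => y [/=]; rewrite !in_itv/= => /andP[_ yx] /andP[xy _].
  by move: (lt_le_trans yx xy); rewrite ltxx.
rewrite integral_itv_bndo_bndc; last exact: mh.
have -> : (\int[lebesgue_measure]_(y in `[(x - 1)%R, x]) h y =
    \int[lebesgue_measure]_(y in `[(x - 1)%R, x]) (1 * a * expR (a * (y - x)))%:E)%E.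
  apply: eq_integral => y; rewrite inE/= in_itv/= => /andP[_ yx].
  by rewrite /h ger0_norm ?subr_ge0// mul1r -mulrN opprB.
have -> : (\int[lebesgue_measure]_(y in `[x, (x + 1)%R]) h y =
    \int[lebesgue_measure]_(y in `[x, (x + 1)%R]) (-1 * - a * expR (- a * (y - x)))%:E)%E.
  apply: eq_integral => y; rewrite inE/= in_itv/= => /andP[xy _].
  by rewrite /h ler0_norm ?subr_le0// mulrNN mul1r opprB mulNr.
rewrite !integral_expR_affine; [|lra|lra].
rewrite -EFinD lee_fin subrr !mulr0 expR0.
by have := expR_ge0 (a * (x - 1 - x)); have := expR_ge0 (- a * (x + 1 - x)); lra.
Qed.

End Cusp.

(** * Mass of the strips along the upper and right edges of the square *)

Section Strips.
Context {R : realType}.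
Implicit Types (rho : @density R).
Local Notation lebesgue := (@lebesgue_measure R).
Local Notation lebesgue2 := (@lebesgue_measure R \x @lebesgue_measure R)%E.

(** Bounds a marginal density uniformly in [a]: the 3 is 1 from the constant term plus 2 from the
    Laplace kernel. *)
Lemma integral_section_le (H : R -> \bar R) (K a x : R) : measurable_fun setT H ->
  (forall y, (0 <= H y)%E) -> 0 <= K -> 0 < a -> 0 <= x <= 1 ->
  (forall y, ~ 0 <= y <= 1 -> H y = 0%E) ->
  (forall y, 0 <= y <= 1 -> (H y <= (K * (1 + a * expR (- (a * `|x - y|))))%:E)%E) ->
  (\int[lebesgue]_y H y <= (3 * K)%:E)%E.
Proof.
move=> mH H0 K0 a0 x01 Hout Hin.
pose e y := a * expR (- (a * `|x - y|)).
have e0 y : 0 <= e y by rewrite mulr_ge0 ?expR_ge0 ?ltW.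
have me (D : set R) : measurable_fun D (EFin \o e).
  apply/measurable_EFinP/measurable_funTS; apply: measurable_funM => //.
  apply: measurableT_comp => //; apply: measurableT_comp => //.
  apply: measurable_funM => //; apply: measurableT_comp => //.
  exact: measurable_funB.
rewrite -(setUv `[0, 1]%classic) ge0_integral_setU//; last 3 first.
- exact: measurableC.
- by rewrite setUv.
- exact/disj_setPCl.
rewrite [X in (_ + X)%E]integral0_eq ?adde0; last first.
  by move=> y /= /negP; rewrite in_itv/= => /negP; exact: Hout.
apply: (@le_trans _ _ (\int[lebesgue]_(y in `[0%R, 1%R]) (K%:E * (1 + (e y)%:E)))%E).
  apply: ge0_le_integral => //.
  - exact: measurable_funTS.
  - apply: measurable_funeM; apply: emeasurable_funD => //; exact: me.
rewrite ge0_integralZl//; last 2 first.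
- by apply: emeasurable_funD => //; exact: me.
- by move=> y _; rewrite -EFinD lee_fin addr_ge0.
rewrite mulrC EFinM lee_wpmul2l// ge0_integralD//; last 2 first.
- by move=> y _; rewrite lee_fin.
- exact: me.
rewrite integral_cst//= lebesgue_measure_itv/= lte_fin ltr01 mul1e oppr0 adde0.
rewrite (_ : 3 = 1 + 2); last by ring.
by rewrite EFinD leeD2l// integral_laplace_le.
Qed.

(** Two strips of width [1 - s] cover the complement within the unit square up to a null set, and
    each has mass at most its width times the bound [3 * K] on a marginal density. *)
Lemma mu_strip_le rho (K : R) (a : R -> R) (s : R) : 0 <= K -> 0 <= s <= 1 ->
  (forall x, x < 1 -> 0 < a x) ->
  (forall p, unit_square p -> p.1 < 1 ->
    rho p <= K * (1 + a p.1 * expR (- (a p.1 * `|p.1 - p.2|)))) ->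
  (forall p, unit_square p -> p.2 < 1 ->
    rho p <= K * (1 + a p.2 * expR (- (a p.2 * `|p.1 - p.2|)))) ->
  (mu_ rho (~` (`[0%R, s]%classic `*` `[0%R, s]%classic)) <= (6 * K * (1 - s))%:E)%E.
Proof.
move=> K0 /andP[s0 s1] a0 b1 b2.
(* The strips stop short of 1 because the bounds on [rho] concern a coordinate below 1; the lines
   [x = 1] and [y = 1] join the cover later, as null sets. *)
pose S1 : set (R * R) := `[s, 1[%classic `*` `[0, 1]%classic.
pose S2 : set (R * R) := `[0, 1]%classic `*` `[s, 1[%classic.
have mS1 : measurable S1 by exact: measurableX.
have mS2 : measurable S2 by exact: measurableX.
have S1S : S1 `<=` unit_square.
  move=> [x y] [/=]; rewrite !in_itv/= => /andP[sx x1] y01.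
  by split; rewrite /= in_itv//= (ltW x1) (le_trans s0 sx).
have S2S : S2 `<=` unit_square.
  move=> [x y] [/=]; rewrite !in_itv/= => x01 /andP[sy y1].
  by split; rewrite /= in_itv//= (ltW y1) (le_trans s0 sy).
have mrho (A : set (R * R)) : measurable A -> A `<=` unit_square ->
    measurable_fun setT ((EFin \o rho) \_ A).
  move=> mA AS; apply/(measurable_restrictT _ _).1 => //.
  apply/measurable_EFinP; apply: measurable_funS AS _; first exact: measurable_unit_square.
  exact: density_measurable.
have rho0 (A : set (R * R)) p : A `<=` unit_square -> (0 <= ((EFin \o rho) \_ A) p)%E.
  by move=> AS; apply: erestrict_ge0 => q /AS Sq; rewrite lee_fin density_ge0.
have indS : (\int[lebesgue]_x ((3 * K)%:E * (\1_(`[s, 1%R[) x)%:E) = (3 * K * (1 - s))%:E)%E.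
  rewrite ge0_integralZl//; last 2 first.
  - by apply/measurable_EFinP; exact: measurable_indic.
  - by rewrite lee_fin mulr_ge0.
  rewrite integral_indic// setIT/= lebesgue_measure_itv/= lte_fin.
  case: ifPn => [_|]; first by rewrite -EFinB -EFinM.
  rewrite -leNgt => s1'; rewrite mule0 (_ : s = 1) ?subrr ?mulr0//.
  by apply/eqP; rewrite eq_le s1.
have m1 : (mu_ rho S1 <= (3 * K * (1 - s))%:E)%E.
  rewrite /mu_ (setIidl S1S) integral_mkcond fubini_tonelli1//; last 2 first.
  - exact: mrho.
  - by move=> p; exact: rho0.
  rewrite -indS; apply: ge0_le_integral => //.
  - by move=> x _; apply: integral_ge0 => y _; exact: rho0.
  - by apply: measurable_fun_fubini_tonelli_F; [exact: mrho|move=> p; exact: rho0].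
  - by apply: measurable_funeM; apply/measurable_EFinP; exact: measurable_indic.
  move=> x _; rewrite indicE; case: (boolP (x \in _)) => [|xs].
    rewrite inE/= in_itv/= => /andP[sx x1]; rewrite mule1.
    apply: (@integral_section_le _ _ (a x) x) => //.
    - by apply: measurable_fun_pair2; exact: mrho.
    - by move=> y; exact: rho0.
    - exact: a0.
    - by rewrite (le_trans s0 sx) (ltW x1).
    - by move=> y ny; rewrite /patch ifN//; apply/negP; rewrite inE => -[_ /=]; rewrite in_itv.
    - move=> y y01; have Sxy : S1 (x, y) by split; rewrite /= in_itv//= sx.
      by rewrite /patch mem_set//= lee_fin; apply: b1 => //; exact: S1S.
  rewrite mule0 /fubini_F integral0_eq// => y _; rewrite /patch ifN//.
  by apply: contra xs; rewrite !inE => -[].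
have m2 : (mu_ rho S2 <= (3 * K * (1 - s))%:E)%E.
  rewrite /mu_ (setIidl S2S) integral_mkcond fubini_tonelli1//; last 2 first.
  - exact: mrho.
  - by move=> p; exact: rho0.
  (* The order of integration is exchanged, so that the inner integral runs along the strip. *)
  rewrite /fubini_F fubini_tonelli//; last 2 first.
  - exact: mrho.
  - by move=> p; exact: rho0.
  rewrite -indS; apply: ge0_le_integral => //.
  - by move=> x _; apply: integral_ge0 => y _; exact: rho0.
  - by apply: measurable_fun_fubini_tonelli_G; [exact: mrho|move=> p; exact: rho0].
  - by apply: measurable_funeM; apply/measurable_EFinP; exact: measurable_indic.
  move=> y _; rewrite indicE; case: (boolP (y \in _)) => [|ys].
    rewrite inE/= in_itv/= => /andP[sy y1]; rewrite mule1.
    apply: (@integral_section_le _ _ (a y) y) => //.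
    - by apply: measurable_fun_pair1; exact: mrho.
    - by move=> x; exact: rho0.
    - exact: a0.
    - by rewrite (le_trans s0 sy) (ltW y1).
    - by move=> x nx; rewrite /patch ifN//; apply/negP; rewrite inE => -[/=]; rewrite in_itv.
    - move=> x x01; have Sxy : S2 (x, y) by split; rewrite /= in_itv//= sy.
      by rewrite /patch mem_set//= lee_fin distrC; apply: b2 => //; exact: S2S.
  rewrite mule0 integral0_eq// => x _; rewrite /patch ifN//.
  by apply: contra ys; rewrite !inE => -[].
have [_ /(_ 1)[n1 n2]] := mu_pre_permuton rho.
set bad := ~` _.
have mbad : measurable bad by apply: measurableC; exact: measurableX.
have -> : mu_ rho bad = mu_ rho (bad `&` unit_square) by rewrite /mu_ -setIA setIid.
have mN1 : measurable ([set 1] `*` setT : set (R * R)) by exact: measurableX.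
have mN2 : measurable (setT `*` [set 1] : set (R * R)) by exact: measurableX.
apply: (@le_trans _ _ (mu_ rho ((S1 `|` S2) `|` ([set 1%R] `*` setT `|` setT `*` [set 1%R])))).
  apply: le_measure; rewrite ?inE.
  - by apply: measurableI => //; exact: measurable_unit_square.
  - by apply: measurableU; exact: measurableU.
  move=> [x y] [/= nG [/=]]; rewrite !in_itv/= => /andP[x0 x1] /andP[y0 y1].
  have [xe|xe] := eqVneq x 1; first by right; left.
  have [ye|ye] := eqVneq y 1; first by right; right.
  have x1' : x < 1 by rewrite lt_neqAle xe.
  have y1' : y < 1 by rewrite lt_neqAle ye.
  left; have [sx|xs] := leP s x.
    by left; split; rewrite /= in_itv/= ?sx ?x1' ?y0.
  right; split; rewrite /= in_itv/= ?x0// y1' andbT leNgt; apply/negP => ys.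
  by apply: nG; split; rewrite /= in_itv/= ?x0 ?y0 ltW.
have mu_le A B : measurable A -> measurable B -> (mu_ rho (A `|` B) <= mu_ rho A + mu_ rho B)%E.
  by move=> mA mB; exact: measureU2.
apply: le_trans (mu_le _ _ (measurableU _ _ mS1 mS2) (measurableU _ _ mN1 mN2)) _.
have N0 : (mu_ rho ([set 1%R] `*` setT `|` setT `*` [set 1%R]) <= 0)%E.
  by apply: le_trans (mu_le _ _ mN1 mN2) _; rewrite n1 n2 adde0.
rewrite -[leRHS]adde0 leeD//.
apply: le_trans (mu_le _ _ mS1 mS2) _.
by rewrite (_ : 6 * K * (1 - s) = 3 * K * (1 - s) + 3 * K * (1 - s)) ?EFinD ?leeD//; ring.
Qed.

End Strips.

(** * The grid *)

Section Grid.
Context {R : realType}.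
Implicit Types (rho : @density R) (alpha s x : R) (k : nat).

(* For [alpha = g / 2 - 1] each cell carries mass of order [1 / s ^ 2] with respect to
   [(1 - x) ^ (- g / 2) * (1 - y) ^ (- g / 2) dx dy]. *)
Definition grid alpha s x : nat := Num.truncn (s * (1 - x) `^ (- alpha)).

Lemma powRN_ge1 (t r : R) : 0 < t -> t <= 1 -> 0 <= r -> 1 <= t `^ (- r).
Proof. by move=> t0 t1 r0; have := powRN_le t0 t1 r0; rewrite powR1. Qed.

Lemma grid_homo alpha s : 0 <= alpha -> 0 <= s ->
  {in [set x : R | x < 1] &, {homo grid alpha s : x y / x <= y >-> (x <= y)%N}}.
Proof.
move=> a0 s0 x y; rewrite !inE /= => x1 y1 xy; apply: le_truncn.
by apply: ler_wpM2l => //; apply: powRN_le => //; [rewrite subr_gt0|rewrite lerB].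
Qed.

(** Inverts [k <= s * (1 - x) ^ (- alpha) < k + 1]. Level 0 is empty since the middle term is at
    least [s >= 1]. *)
Lemma grid_bounds alpha s x k : 0 < alpha -> 1 <= s -> 0 <= x < 1 -> grid alpha s x = k ->
  [/\ (0 < k)%N, (s / k.+1%:R) `^ alpha^-1 <= 1 - x, 1 - x <= (s / k%:R) `^ alpha^-1 &
    (1 - x) `^ (- (alpha + 1)) <= (s / k.+1%:R) `^ (- (1 + alpha^-1))].
Proof.
move=> a0 s1 /andP[x0 x1] fk.
have s0 : 0 < s by exact: lt_le_trans s1.
have t0 : 0 < 1 - x by rewrite subr_gt0.
have t1 : 1 - x <= 1 by rewrite gerBl.
set t := 1 - x in t0 t1 *; set v := s * t `^ (- alpha).
have v1 : 1 <= v.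
  by rewrite /v -[leLHS]mulr1 ler_pM// powRN_ge1// ltW.
have v0 : 0 < v by exact: lt_le_trans v1.
have /truncn_itv : 0 <= v by exact: ltW.
rewrite (_ : Num.truncn v = k)// => /andP[kv vk].
have k0 : (0 < k)%N by rewrite -fk /grid truncn_gt0.
have kR : 0 < k%:R :> R by rewrite ltr0n.
have tv : t = (s / v) `^ alpha^-1.
  rewrite /v invfM mulrA mulfV ?gt_eqF// mul1r powRN invrK -powRrM.
  by rewrite mulfV ?gt_eqF// powRr1// ltW.
have lo : (s / k.+1%:R) `^ alpha^-1 <= t.
  rewrite tv ge0_ler_powR ?nnegrE ?invr_ge0 ?divr_ge0 ?(ltW s0) ?(ltW a0) ?(ltW v0)//.
  by rewrite ler_wpM2l ?(ltW s0)// lef_pV2 ?posrE// ltW.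
split => //.
  rewrite [leLHS]tv ge0_ler_powR ?nnegrE ?invr_ge0 ?divr_ge0 ?(ltW s0) ?(ltW a0) ?(ltW v0)//.
  by rewrite ler_wpM2l ?(ltW s0)// lef_pV2 ?posrE.
have sk0 : 0 < s / k.+1%:R by rewrite divr_gt0.
apply: le_trans (powRN_le _ lo _) _; first by rewrite powR_gt0.
  by rewrite addr_ge0// ltW.
by rewrite -powRrM mulrN mulrDr mulVf ?gt_eqF// mulr1.
Qed.

Lemma measurable_grid_cell alpha s (D : set R) k : 0 <= s -> measurable D ->
  measurable (D `&` grid alpha s @^-1` [set k]).
Proof.
move=> s0 mD; pose h x := s * (1 - x) `^ (- alpha).
have -> : grid alpha s @^-1` [set k] = h @^-1` `[k%:R, k.+1%:R[%classic.
  apply/seteqP; split => x /=; rewrite in_itv/=.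
    by move=> <-; apply: truncn_itv; rewrite mulr_ge0// powR_ge0.
  exact: truncn_def.
have mh : measurable_fun D h.
  apply: measurable_funTS; apply: measurable_funM => //.
  by apply: (measurableT_comp (measurable_powR _)) => //; exact: measurable_funB.
exact: mh.
Qed.

Lemma exprn_1D_le (h : R) n : 0 <= h <= 1 -> (1 + h) ^+ n <= 1 + 2 ^+ n * h.
Proof.
(* The stronger claim, with the chord of the convex function over [[0, 1]], passes through the
   induction. *)
move=> /andP[h0 h1]; suff : (1 + h) ^+ n <= 1 + (2 ^+ n - 1) * h by nra.
elim: n => [|n IH]; first by rewrite !expr0 subrr mul0r addr0.
rewrite !exprS; have : 1 <= 2 ^+ n :> R by rewrite exprn_ege1// ler1n.
move: IH; set u := (1 + h) ^+ n; set w := 2 ^+ n => IH w1.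
apply: (@le_trans _ _ ((1 + h) * (1 + (w - 1) * h))); first by rewrite ler_wpM2l// addr_ge0.
by have := mulr_ge0 (mulr_ge0 (_ : 0 <= w - 1) h0) (_ : 0 <= 1 - h); rewrite !subr_ge0; nra.
Qed.

(** Supremum of [(1 - x) ^ (- (alpha + 1))] on a level, times its width. With [a = s / (k + 1)] and
    [s / k = a * (1 + 1 / k)] it becomes [((1 + 1 / k) ^ (1 / alpha) - 1) / a], which is of order
    [1 / s] uniformly in [k]. *)
Lemma grid_cell_mass alpha s k : 0 < alpha -> 0 < s -> (0 < k)%N ->
  (s / k.+1%:R) `^ (- (1 + alpha^-1)) *
    ((s / k%:R) `^ alpha^-1 - (s / k.+1%:R) `^ alpha^-1) <=
  2 ^+ (Num.truncn alpha^-1).+2 / s.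
Proof.
move=> a0 s0 k0; have kR : 0 < k%:R :> R by rewrite ltr0n.
(* [n] is an integer above the exponent [alpha^-1], so that [exprn_1D_le] applies. *)
set n := (Num.truncn alpha^-1).+1; set a := s / k.+1%:R.
have ai0 : 0 < alpha^-1 by rewrite invr_gt0.
have aA : 0 < a by rewrite divr_gt0.
have -> : s / k%:R = a * (1 + k%:R^-1).
  by rewrite /a -natr1; field; rewrite gt_eqF//= natr1 pnatr_eq0.
have k1 : 0 <= (k%:R^-1 : R) <= 1 by rewrite invr_ge0 ltW//= invf_le1// ler1n.
have h1 : 1 <= 1 + k%:R^-1 :> R by rewrite lerDl invr_ge0 ltW.
have pw : (1 + k%:R^-1) `^ alpha^-1 <= 1 + 2 ^+ n * k%:R^-1.
  apply: le_trans (exprn_1D_le n k1); rewrite -powR_mulrn ?(le_trans _ h1)//.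
  by apply: ler_powR => //; rewrite ltW// -truncn_lt_nat// ltW.
rewrite powRM ?(ltW aA) ?(le_trans _ h1)// -[X in _ - X]mulr1 -mulrBr mulrA.
rewrite -powRD ?(gt_eqF aA) ?implybT//.
have -> : - (1 + alpha^-1) + alpha^-1 = -1 by ring.
rewrite powR_inv1 ?(ltW aA)//.
apply: (@le_trans _ _ (a^-1 * (2 ^+ n * k%:R^-1))).
  by rewrite ler_wpM2l ?invr_ge0 ?(ltW aA)// lerBlDl.
rewrite /a invf_div mulrAC ler_wpM2r ?invr_ge0 ?(ltW s0)//.
rewrite mulrCA exprSr ler_wpM2l ?exprn_ge0// ler_pdivrMr//.
by rewrite -natr1 mulr2n mulrDl mul1r lerD2l ler1n.
Qed.

(** The cell lies in a rectangle on which the density bound has product form, so [grid_cell_mass]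
    applies to each coordinate separately. *)
Lemma mu_grid_cell_le rho (K c alpha : R) : 0 < K -> 0 < c -> 0 < alpha ->
  (forall p, unit_square p -> p != (1, 1) -> rho p <= K * (1 + cusp c (2 * (alpha + 1)) p)) ->
  exists2 C : R, 0 < C & forall (s u : R) (k l : nat), 1 <= s -> u < 1 ->
   (mu_ rho ((`[0%R, u]%classic `&` grid alpha s @^-1` [set k]) `*`
             (`[0%R, u]%classic `&` grid alpha s @^-1` [set l])) <= (C / s ^+ 2)%:E)%E.
Proof.
move=> K0 c0 a0 rhoK; pose D : R := 2 ^+ (Num.truncn alpha^-1).+2.
have D0 : 0 < D by rewrite exprn_gt0.
exists (2 * K * D ^+ 2); first by apply: mulr_gt0; [rewrite mulr_gt0|rewrite exprn_gt0].
move=> s u k l s1 u1; pose J m : set R := `[0, u]%classic `&` grid alpha s @^-1` [set m].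
rewrite -/(J k) -/(J l).
have s0 : 0 < s by exact: lt_le_trans s1.
have JP m x : J m x -> 0 <= x < 1 /\ grid alpha s x = m.
  by move=> [/=]; rewrite in_itv/= => /andP[-> /le_lt_trans->].
have mJ m : measurable (J m) by apply: measurable_grid_cell => //; exact: ltW.
have C0 : (0 <= (2 * K * D ^+ 2 / s ^+ 2)%:E)%E.
  rewrite lee_fin; apply: divr_ge0; last exact: sqr_ge0.
  by apply: mulr_ge0; [rewrite mulr_ge0// ltW|exact: sqr_ge0].
(* Level 0 is empty; it is set apart because [hi 0] would divide by zero. *)
have [k0|k0] := posnP k.
  rewrite (_ : _ `*` _ = set0) ?measure0//; apply/seteqP; split => // -[x y] [/JP[x01 gx] _].
  by have [] := grid_bounds a0 s1 x01 gx; rewrite k0.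
have [l0|l0] := posnP l.
  rewrite (_ : _ `*` _ = set0) ?measure0//; apply/seteqP; split => // -[x y] [_ /JP[y01 gy]].
  by have [] := grid_bounds a0 s1 y01 gy; rewrite l0.
pose lo m : R := (s / m.+1%:R) `^ alpha^-1; pose hi m : R := (s / m%:R) `^ alpha^-1.
pose U m : R := (s / m.+1%:R) `^ (- (1 + alpha^-1)).
have U0 m : 0 <= U m by exact: powR_ge0.
have lohi m : (0 < m)%N -> lo m <= hi m.
  move=> m0; rewrite ge0_ler_powR ?nnegrE ?invr_ge0 ?divr_ge0 ?(ltW s0) ?(ltW a0)//.
  by rewrite ler_wpM2l ?(ltW s0)// lef_pV2 ?posrE ?ltr0n// ler_nat.
apply: le_trans (@mu_box_le _ rho _ (1 - hi k) (1 - lo k) (1 - hi l) (1 - lo l)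
    (2 * K * (U k * U l)) _ _ _ _ _ _) _.
- exact: measurableX.
- by rewrite lerB ?lohi.
- by rewrite lerB ?lohi.
- by rewrite !mulr_ge0// ltW.
- move=> [x y] [/= /JP[x01 gx] /JP[y01 gy]].
  have [_ ? ? _] := grid_bounds a0 s1 x01 gx; have [_ ? ? _] := grid_bounds a0 s1 y01 gy.
  by split; rewrite /= in_itv/= /lo /hi; apply/andP; split; lra.
- move=> [x y] [/= /JP[x01 gx] /JP[y01 gy]] Sxy.
  have [_ _ _ Ux] := grid_bounds a0 s1 x01 gx; have [_ _ _ Uy] := grid_bounds a0 s1 y01 gy.
  have /andP[x0 x1] := x01; have /andP[y0 y1] := y01.
  have xy1 : (x, y) != (1, 1) by rewrite xpair_eqE (lt_eqF x1).
  have g0 : 0 < 2 * (alpha + 1) by rewrite mulr_gt0// addr_gt0.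
  apply: le_trans (rhoK _ Sxy xy1) _.
  have := @cusp_le_prod _ c _ (x, y) c0 g0 x1 y1.
  rewrite /= (_ : 2 * (alpha + 1) / 2 = alpha + 1); last by field.
  move=> cU.
  have ge1 z : 0 <= z < 1 -> 1 <= (1 - z) `^ (- (alpha + 1)).
    by move=> /andP[z0 z1]; rewrite powRN_ge1 ?subr_gt0 ?gerBl// addr_ge0// ltW.
  have := ge1 _ x01; have := ge1 _ y01; move: Ux Uy cU; rewrite -/(U k) -/(U l).
  set Tx := _ `^ (- _); set Ty := (1 - y) `^ _; move=> Ux Uy cU Ty1 Tx1.
  rewrite -mulrA mulrCA ler_wpM2l ?(ltW K0)//.
  have UU : Tx * Ty <= U k * U l by apply: ler_pM => //; apply: le_trans ler01 _.
  (* The summand 1 in the bound on [rho] is absorbed by the product, at the cost of the factor 2. *)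
  have TT : 1 <= Tx * Ty by rewrite -[leLHS]mulr1 ler_pM.
  lra.
rewrite lee_fin !opprB !addrA.
have mk := grid_cell_mass a0 s0 k0; have ml := grid_cell_mass a0 s0 l0.
have -> : 2 * K * (U k * U l) * ((1 - lo k + hi k - 1) * (1 - lo l + hi l - 1)) =
  2 * K * ((U k * (hi k - lo k)) * (U l * (hi l - lo l))) by ring.
have -> : 2 * K * D ^+ 2 / s ^+ 2 = 2 * K * (D / s * (D / s)).
  by field; rewrite gt_eqF.
rewrite ler_wpM2l ?mulr_ge0 ?(ltW K0)//.
by apply: ler_pM => //; rewrite mulr_ge0// subr_ge0 lohi.
Qed.

End Grid.

(** * The two bounds *)

Section Main.
Context {R : realType}.
Variables (beta c : R) (rho : @density R).
Hypotheses (hbeta : 1 < beta < 2) (hc : 0 < c).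
Let g := beta / (beta - 1).
Hypothesis rho_cont : {within unit_square `\ (1, 1), continuous rho}.
Hypothesis rho_asymp : Theta_at_11 rho (cusp c g).

Let b1 : 1 < beta. Proof. by case/andP: hbeta. Qed.
Let b2 : beta < 2. Proof. by case/andP: hbeta. Qed.
Let b0 : 0 < beta. Proof. exact: lt_trans b1. Qed.
Let bm1 : 0 < beta - 1. Proof. by rewrite subr_gt0. Qed.
Let g0 : 0 < g. Proof. by rewrite divr_gt0. Qed.
Let alpha := g / 2 - 1.

(** [beta < 2] amounts to [g > 2]. *)
Let alpha0 : 0 < alpha.
Proof.
rewrite /alpha /g subr_gt0 ltr_pdivlMr// mul1r ltr_pdivlMr//.
by have := b2; lra.
Qed.

Lemma cusp_sym (c' g' : R) x y : cusp c' g' (x, y) = cusp c' g' (y, x).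
Proof. by rewrite /cusp /= (addrC `|x - 1|) (distrC x y). Qed.

Section Sizes.
Variable N : nat.
Hypothesis N0 : (0 < N)%N.
Let NR0 : 0 < N%:R :> R. Proof. by rewrite ltr0n. Qed.
Let NR1 : 1 <= N%:R :> R. Proof. by rewrite ler1n. Qed.

(** The distance [d] to the corner at which [d ^ (- g)] equals [N]. *)
Definition depth : R := N%:R `^ (- g^-1).

Lemma depth_gt0 : 0 < depth. Proof. by rewrite powR_gt0. Qed.

Lemma depth_le1 : depth <= 1.
Proof.
by rewrite /depth powRN invf_le1 ?powR_gt0// powR_ge1// invr_ge0 ltW.
Qed.

Lemma depth_powN : depth `^ (- g) = N%:R.
Proof. by rewrite /depth -powRrM mulrNN mulVf ?gt_eqF// powRr1// ltW. Qed.

(** [1 - 1 / g = 1 / beta]. *)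
Lemma size_mul_depth : N%:R * depth = N%:R `^ beta^-1.
Proof.
rewrite /depth -{1}(powRr1 (ltW NR0)) -powRD ?(gt_eqF NR0) ?implybT//; congr powR.
by rewrite /g; field; rewrite !gt_eqF.
Qed.

(** The highest grid level, attained at [1 - x = depth], has order [N ^ (1 / beta)], as
    [1 / 2 + alpha / g = 1 / beta]. *)
Lemma sqrt_size_depth : N%:R `^ 2^-1 * depth `^ (- alpha) = N%:R `^ beta^-1.
Proof.
rewrite /depth -powRrM -powRD ?(gt_eqF NR0) ?implybT//; congr powR.
by rewrite /alpha /g; field; rewrite !gt_eqF.
Qed.

Lemma size_pow_ge1 : 1 <= N%:R `^ beta^-1 :> R.
Proof. by rewrite powR_ge1// invr_ge0 ltW. Qed.

Lemma size_pow_le : N%:R `^ beta^-1 <= N%:R :> R.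
Proof.
rewrite -[leRHS](powRr1 (ltW NR0)) ler_powR// invf_le1//; exact: ltW.
Qed.

Lemma trunc_size_pow_le : (Num.truncn (N%:R `^ beta^-1 : R))%:R <= N%:R `^ beta^-1 :> R.
Proof. by rewrite truncn_le powR_ge0. Qed.

End Sizes.

Lemma expected_LIS_upper : Otilde (expected_LIS_Sample (mu_ rho)) (fun N => N%:R `^ beta^-1).
Proof.
have [K [_ [_ [K0 _ _ HK _]]]] := density_cusp_bounds rho_cont rho_asymp.
have [K2 [k2 [K20 k20 HK2]]] := cusp_le_laplace hc hbeta.
have gE : 2 * (alpha + 1) = g by rewrite /alpha; field.
have HK' := HK; rewrite -gE in HK'.
have [C C0 HC] := mu_grid_cell_le K0 hc alpha0 HK'.
pose a x := k2 * (1 - x) `^ (- g).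
have a0 x : x < 1 -> 0 < a x by move=> x1; rewrite mulr_gt0// powR_gt0// subr_gt0.
pose K3 := K * (1 + K2).
have K30 : 0 < K3 by rewrite mulr_gt0// addr_gt0.
have comb z w : 0 <= w -> z <= K2 * (1 + w) -> K * (1 + z) <= K3 * (1 + w).
  by move=> w0 zw; rewrite /K3 -mulrA ler_wpM2l ?(ltW K0)//; nra.
have ae0 x z : x < 1 -> 0 <= a x * expR z.
  by move=> x1; rewrite mulr_ge0 ?expR_ge0// ltW// a0.
have bound1 p : unit_square p -> p.1 < 1 ->
    rho p <= K3 * (1 + a p.1 * expR (- (a p.1 * `|p.1 - p.2|))).
  move=> Sp x1; apply: le_trans (HK _ Sp _) _.
    by apply/eqP => pE; rewrite pE ltxx in x1.
  by apply: comb; [exact: ae0|apply: HK2 => //; case: Sp => _ /=; rewrite in_itv/= => /andP[]].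
have bound2 p : unit_square p -> p.2 < 1 ->
    rho p <= K3 * (1 + a p.2 * expR (- (a p.2 * `|p.1 - p.2|))).
  move=> Sp y1; apply: le_trans (HK _ Sp _) _.
    by apply/eqP => pE; rewrite pE ltxx in y1.
  apply: comb; first exact: ae0.
  move: Sp y1; case: p => x y [/=]; rewrite !in_itv/= => /andP[_ x1] _ y1.
  by rewrite cusp_sym distrC; apply: (HK2 (y, x)).
pose E0 : R := expR ((expR 1 - 1) * C).
have E00 : 0 < E0 by exact: expR_gt0.
(* [6 * K3] comes from the edge strips, the rest from [3 * T * (L + 4 * E0)]. Beyond the threshold
   [ln N >= 1], so the logarithm absorbs the constant terms. *)
exists (6 * K3 + 6 + 12 * E0), 1, (Num.truncn (expR 1 : R)).+1; split.
  by rewrite !addr_gt0// mulr_gt0.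
move=> N NN0; have N0 : (0 < N)%N by exact: leq_ltn_trans NN0.
have NR0 : 0 < N%:R :> R by rewrite ltr0n.
have NR1 : 1 <= N%:R :> R by rewrite ler1n.
have lnN1 : 1 <= ln N%:R :> R.
  rewrite -ler_expR lnK ?posrE// ltW//.
  by rewrite -truncn_lt_nat// expR_ge0.
have tau0 := depth_gt0 N0; have tau1 := depth_le1 N0.
(* With [s ^+ 2 = N] a cell has mass at most [C / N], so the exponential moment of its count is at
   most the constant [E0]. *)
pose s : R := N%:R `^ 2^-1.
have s1 : 1 <= s by rewrite powR_ge1.
have s0 : 0 < s by exact: lt_le_trans s1.
have s2 : s ^+ 2 = N%:R.
  by rewrite -(powR_mulrn _ (ltW s0)) /s -powRrM mulVf// powRr1// ltW.
pose u := 1 - depth N; pose T : R := N%:R `^ beta^-1; pose M := Num.truncn T.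
have u1 : u < 1 by rewrite gtrBl.
have u0 : 0 <= u by rewrite subr_ge0.
have T1 : 1 <= T := size_pow_ge1 N0.
have TN : T <= N%:R := size_pow_le N0.
have MT : M%:R <= T := trunc_size_pow_le N.
(* [expR (- L) = N ^ (-2)] compensates the [(M + 1) ^ 2 <= 4 * N ^ 2] cells. *)
pose L : R := 2 * ln N%:R.
have L0 : 0 <= L by rewrite mulr_ge0// (le_trans _ lnN1).
have G1 x : `[0, u]%classic x -> x < 1.
  by rewrite /= in_itv/= => /andP[_ /le_lt_trans]; apply.
rewrite powRr1 ?(le_trans _ lnN1)//.
apply: le_trans (expected_LIS_le (M := M) (G := `[0, u]%classic) (f := grid alpha s)
  (delta := C / s ^+ 2) (eta := 6 * K3 * (1 - u)) N (mu_pre_permuton rho) _ _ _ _ L0 _ _) _.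
- move=> x y; rewrite !inE => /G1 x1 /G1 y1.
  by apply: grid_homo; rewrite ?inE// ltW.
- move=> x Gx; apply: le_truncn; rewrite /T -(sqrt_size_depth N0) -/s ler_wpM2l ?(ltW s0)//.
  apply: powRN_le; [exact: tau0| |exact: ltW].
  by move: Gx; rewrite /= in_itv/= /u => /andP[_]; lra.
- by [].
- by move=> k; apply: measurable_grid_cell => //; exact: ltW.
- by move=> k l; exact: HC.
- by apply: (mu_strip_le (a := a)) => //; [exact: ltW|rewrite u0 ltW].
have -> : (expR 1 - 1) * (C / s ^+ 2 * N%:R) = (expR 1 - 1) * C.
  by rewrite s2 mulfVK// gt_eqF.
rewrite -/E0.
have -> : N%:R * (6 * K3 * (1 - u)) = 6 * K3 * T.
  by rewrite /u subKr mulrCA size_mul_depth.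
have M2 : (M.*2.+1)%:R <= 3 * T.
  by rewrite -addn1 natrD -muln2 natrM; lra.
have eL : expR (- L) = (N%:R ^+ 2)^-1.
  by rewrite expRN /L expRM_natl lnK.
have M1 : expR (- L) * ((M.+1 ^ 2)%:R * E0) <= 4 * E0.
  rewrite mulrA ler_wpM2r ?(ltW E00)// eL mulrC ler_pdivrMr ?exprn_gt0//.
  have MN : M.+1%:R <= 2 * N%:R :> R by rewrite -natr1; lra.
  rewrite natrX (_ : 4 * N%:R ^+ 2 = (2 * N%:R) ^+ 2); last by ring.
  by apply: lerXn2r; rewrite ?nnegrE// mulr_ge0// ltW.
apply: (@le_trans _ _ (6 * K3 * T + 3 * T * (L + 4 * E0))).
  rewrite lerD2l; apply: ler_pM => //; last by rewrite lerD2l.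
  by rewrite addr_ge0// mulr_ge0 ?expR_ge0// mulr_ge0// ltW.
have T0 : 0 < T by exact: lt_le_trans T1.
have -> : 6 * K3 * T + 3 * T * (L + 4 * E0) = (6 * K3 + 6 * ln N%:R + 12 * E0) * T.
  by rewrite /L; ring.
rewrite ler_wpM2r ?(ltW T0)//.
by nra.
Qed.

Lemma expected_LIS_lower : Otilde (fun N => N%:R `^ beta^-1) (expected_LIS_Sample (mu_ rho)).
Proof.
have [_ [k [e [_ k0 e0 _ Hk]]]] := density_cusp_bounds rho_cont rho_asymp.
(* On the squares used below [2 * tau <= d <= 4 * tau] and [|x - y| <= 1 / N]. Hence [d ^ (- g)]
   lies between [4 ^ (- g) * N] and [2 ^ (- g) * N], and [rho] is at least [kap * N]. *)
pose kap : R := k * (4 `^ (- g) * expR (- (c * 2 `^ (- g)))).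
have kap0 : 0 < kap by rewrite mulr_gt0// mulr_gt0 ?expR_gt0// powR_gt0.
pose q : R := 1 - expR (- kap).
have q0 : 0 < q by rewrite subr_gt0 -expR0 ltr_expR oppr_lt0.
pose eta := Num.min e 1 / 2.
have eta0 : 0 < eta by rewrite divr_gt0// lt_min e0 ltr01.
(* The 2 is lost in truncating [T], and [q] bounds below the probability that a square is hit. The
   threshold forces [depth N < eta], which puts the squares where the lower bound on [rho] holds. *)
exists (2 / q), 0, (Num.truncn (eta `^ (- g))).+1; split; first by rewrite divr_gt0.
move=> N NN0; have N0 : (0 < N)%N by exact: leq_ltn_trans NN0.
have NR0 : 0 < N%:R :> R by rewrite ltr0n.
have tau0 := depth_gt0 N0; have tau1 := depth_le1 N0.
set tau := depth N in tau0 tau1.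
have taueta : tau < eta.
  rewrite ltNge; apply/negP => le_eta.
  have := powRN_le eta0 le_eta (ltW g0); rewrite depth_powN//.
  by rewrite leNgt -truncn_lt_nat ?powR_ge0// NN0.
have [tau_e tau_1] : 2 * tau < e /\ 2 * tau < 1.
  have : 2 * tau < Num.min e 1 by move: taueta; rewrite /eta; lra.
  by rewrite lt_min => /andP[].
pose T : R := N%:R `^ beta^-1; pose m := Num.truncn T.
have T1 : 1 <= T := size_pow_ge1 N0.
have m1 : (0 < m)%N by rewrite truncn_gt0.
have mT : m%:R <= T := trunc_size_pow_le N.
have Tm : T <= 2 * m%:R.
  have /truncn_itv/andP[_ /ltW] : 0 <= T by exact: le_trans T1.
  rewrite -/m -natr1 => /le_trans; apply.
  by have : 1 <= m%:R :> R by [rewrite ler1n]; lra.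
have mtau : m%:R / N%:R <= tau.
  by rewrite ler_pdivrMr// mulrC size_mul_depth.
rewrite powRr0 mulr1.
(* Successive intervals of length [1 / N] from [1 - 2 * tau] on; by [mtau] the last one ends at or
   before [1 - tau]. *)
pose I (j : 'I_m) : set R := `[1 - 2 * tau + j%:R / N%:R, 1 - 2 * tau + j.+1%:R / N%:R[%classic.
have Iw (j : 'I_m) : 1 - 2 * tau + j%:R / N%:R < 1 - 2 * tau + j.+1%:R / N%:R.
  by rewrite ltrD2l ltr_pM2r ?invr_gt0// ltr_nat.
have Ib (j : 'I_m) x : I j x -> 1 - 2 * tau <= x <= 1 - tau.
  rewrite /I /= in_itv/= => /andP[h1 h2].
  have j0 : 0 <= j%:R / N%:R :> R by rewrite divr_ge0// ltW.
  have jm : j.+1%:R / N%:R <= m%:R / N%:R :> R by rewrite ler_wpM2r ?invr_ge0 ?(ltW NR0)// ler_nat.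
  by apply/andP; split; lra.
have Il (j : 'I_m) x y : I j x -> I j y -> `|x - y| <= N%:R^-1.
  rewrite /I /= !in_itv/= -natr1 mulrDl mul1r => /andP[h1 h2] /andP[h3 h4].
  by rewrite ler_norml; apply/andP; split; lra.
have Ilt (j l : 'I_m) x y : (j < l)%N -> I j x -> I l y -> x < y.
  rewrite /I /= !in_itv/= => jl /andP[_ h1] /andP[h2 _].
  have : j.+1%:R / N%:R <= l%:R / N%:R :> R by rewrite ler_wpM2r ?invr_ge0 ?(ltW NR0)// ler_nat.
  by lra.
have sub (j : 'I_m) x : I j x -> 0 <= x <= 1.
  by move=> /Ib/andP[h1 h2]; apply/andP; split; lra.
have rho_ge (j : 'I_m) p : (I j `*` I j) p -> kap * N%:R <= rho p.
  move: p => [x y] [/= Ix Iy].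
  have /andP[x0 x1] := Ib _ _ Ix; have /andP[y0 y1] := Ib _ _ Iy.
  apply: le_trans (Hk (x, y) _ _ _ _) => /=.
  - rewrite /kap -!mulrA ler_wpM2l ?(ltW k0)// /cusp /=.
    have d2 : 2 * tau <= `|x - 1| + `|y - 1| by rewrite !ler0_norm; lra.
    have d4 : `|x - 1| + `|y - 1| <= 4 * tau by rewrite !ler0_norm; lra.
    have tau2 : 0 < 2 * tau by rewrite mulr_gt0.
    have d0 := lt_le_trans tau2 d2.
    set d := _ + _ in d2 d4 d0 *.
    have h4 : 4 `^ (- g) * N%:R <= d `^ (- g).
      rewrite -(depth_powN N) -powRM ?(ltW tau0)//.
      by apply: powRN_le => //; exact: ltW.
    have h2 : d `^ (- g) <= 2 `^ (- g) * N%:R.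
      rewrite -(depth_powN N) -powRM ?(ltW tau0)//.
      by apply: powRN_le => //; exact: ltW.
    rewrite [X in _ * X <= _]mulrC mulrA; apply: ler_pM => //.
    rewrite ler_expR !mulNr lerN2 -mulrA ler_wpM2l ?(ltW hc)//.
    apply: (@le_trans _ _ (N%:R^-1 * (2 `^ (- g) * N%:R))).
      by apply: ler_pM => //; [exact: powR_ge0|exact: Il Ix Iy].
    by rewrite mulrCA mulVf ?gt_eqF// mulr1.
  - by split; rewrite /= in_itv/=; [exact: sub Ix|exact: sub Iy].
  - by rewrite xpair_eqE negb_and lt_eqF//; lra.
  - lra.
  - lra.
have mass (j : 'I_m) : ((kap / N%:R)%:E <= mu_ rho (I j `*` I j))%E.
  have -> : kap / N%:R = kap * N%:R * (N%:R^-1 * N%:R^-1).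
    by field; rewrite gt_eqF.
  have w : (1 - 2 * tau + j.+1%:R / N%:R) - (1 - 2 * tau + j%:R / N%:R) = N%:R^-1.
    by rewrite -natr1 mulrDl mul1r; ring.
  rewrite -{1 2}w; apply: mu_box_ge => //.
  - by rewrite mulr_ge0// ltW.
  - by move=> [x y] [/= /sub Ix /sub Iy]; split; rewrite /= in_itv.
  - exact: rho_ge.
have mq : 2 / q * (m%:R * q) = 2 * m%:R by field; rewrite gt_eqF.
apply: (le_trans Tm); rewrite -mq ler_wpM2l ?divr_ge0 ?(ltW q0)//.
apply: le_trans (expected_LIS_ge N (mu_pre_permuton rho)
  (A := fun j => I j `*` I j) (p := kap / N%:R) _ _ _).
- by rewrite (divfK (lt0r_neq0 NR0)) -/q.
- by move=> j; apply: measurableX; exact: measurable_itv.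
- move=> j l [x y] [x' y'] jl [/= h1 h2] [/= h3 h4].
  by split; [exact: Ilt jl h1 h3|exact: Ilt jl h2 h4].
- exact: mass.
Qed.

End Main.

Theorem theorem2p2 (R : realType) (beta c : R) (rho : @density R)
  (hbeta : 1 < beta < 2) (hc : 0 < c)
  (rho_cont : {within unit_square `\ (1, 1), continuous rho})
  (rho_asymp :
    Theta_at_11 rho (fun p =>
      let d := `|p.1 - 1| + `|p.2 - 1| in
      d `^ (beta / (1 - beta)) *
      expR (- c * `|p.1 - p.2| * d `^ (beta / (1 - beta))))) :
  Thetatilde (expected_LIS_Sample (mu_ rho)) (fun N => N%:R `^ beta^-1).
Proof.
(* After this rewriting the comparison function is [cusp c (beta / (beta - 1))] by conversion. *)
have gE : beta / (1 - beta) = - (beta / (beta - 1)).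
  by rewrite -opprB invrN mulrN.
rewrite gE in rho_asymp.
by split; [exact: (expected_LIS_upper hbeta hc)|exact: (expected_LIS_lower hbeta hc)].
Qed.
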